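(* Let $p$ be a prime, $n\ge1$ an integer, $0\le\beta<n$, $1\le q,r<\infty$, $1\le s<\infty$, $\min\{\alpha,\gamma\}>-n$, and suppose $$\frac{n+\alpha}{q}-\beta=\frac{n+\gamma}{r}.$$ Let $\Phi$ be a radial function on $\mathbb{Q}_p^n$, $\Phi(\mathbf{x})=\psi(|\mathbf{x}|_p)$ for $\mathbf{x}\ne\mathbf{0}$. Suppose there is $\epsilon>0$ with $q-\epsilon>1$ such that for both $u=q-\epsilon$ and $u=q+\epsilon$, $$\int_0^\infty|\psi(t)|^{u'}\,t^{(n+\alpha)(u'-1)-\beta u'-1}\,dt<\infty,\qquad \frac1u+\frac1{u'}=1.$$ Then there is a constant $C$, independent of $f$, such that for every $f\in L^{q,s}(|\mathbf{x}|_p^\alpha,\mathbb{Q}_p^n)$, $$\|H_{\Phi,\beta}f\|_{L^{r,s}(|\mathbf{x}|_p^\gamma,\mathbb{Q}_p^n)}\le C\,\|f\|_{L^{q,s}(|\mathbf{x}|_p^\alpha,\mathbb{Q}_p^n)}.$$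
   Context: $\mathbb{Q}_p$ is the field of $p$-adic numbers with absolute value $|\cdot|_p$; on $\mathbb{Q}_p^n$ put $|\mathbf{x}|_p=\max_{1\le k\le n}|x_k|_p$. $d\mathbf{x}$ is Haar measure on $\mathbb{Q}_p^n$ normalized so that the unit ball $\{|\mathbf{x}|_p\le1\}$ has measure $1$. The $p$-adic fractional Hausdorff operator is $$H_{\Phi,\beta}f(\mathbf{x})=\int_{\mathbb{Q}_p^n}\frac{\Phi(\mathbf{x}|\mathbf{y}|_p)}{|\mathbf{y}|_p^{n-\beta}}f(\mathbf{y})\,d\mathbf{y},$$ where in $\mathbf{x}|\mathbf{y}|_p$ the number $|\mathbf{y}|_p$ is a power of $p$, regarded as an element of $\mathbb{Q}_p$ multiplying the vector $\mathbf{x}$ (so $\big|\mathbf{x}|\mathbf{y}|_p\big|_p=|\mathbf{x}|_p/|\mathbf{y}|_p$). Convention for the integral over $(0,\infty)$ (ordinary Lebesgue integral): the complex-valued function $\psi$, given on $\{p^k:k\in\mathbb{Z}\}$, is extended to $(0,\infty)$ as a step function, $\psi(t)=\psi(p^k)$ for $p^k\le t<p^{k+1}$. Weighted Lorentz space: for a weight $w\ge0$ on $\mathbb{Q}_p^n$ and measurable $f$, let $\mu_f(\lambda)=\int_{\{\mathbf{x}:|f(\mathbf{x})|>\lambda\}}w(\mathbf{x})\,d\mathbf{x}$ and $f^*(t)=\inf\{\lambda>0:\mu_f(\lambda)\le t\}$ for $t>0$. For $1\le s<\infty$, $$\|f\|_{L^{q,s}(w,\mathbb{Q}_p^n)}=\Big(\frac{s}{q}\int_0^\infty\big[t^{1/q}f^*(t)\big]^s\frac{dt}{t}\Big)^{1/s},$$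 and $L^{q,s}(w,\mathbb{Q}_p^n)$ is the set of $f$ for which this is finite. *)

(* Defs.v *)
From HB Require Import structures.
From mathcomp Require Import all_boot all_order all_algebra fraction generic_quotient.
From mathcomp Require Import all_classical all_reals all_analysis.
From mathcomp Require Import complex.
Set Implicit Arguments.
Unset Strict Implicit.
Unset Printing Implicit Defensive.
Import Order.TTheory GRing.Theory Num.Theory.
Import numFieldNormedType.Exports.

Local Open Scope classical_set_scope.
Local Open Scope ring_scope.

(* An element of Z_p = lim_k Z/p^k is its sequence of residues x_k in          *)
(* {0, ..., p^k - 1}.                                                          *)
Section PadicIntegers.
Variables (p : nat) (p_pr : prime p).

Definition compatible (x : nat -> nat) :=
  forall k, (x k < p ^ k)%N /\ (x k.+1 = x k %[mod p ^ k])%N.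

Record padic_int := PadicInt {
  residue :> nat -> nat;
  residueP : `[< compatible residue >] }.

HB.instance Definition _ := [isSub for residue].
HB.instance Definition _ := gen_eqMixin padic_int.
HB.instance Definition _ := gen_choiceMixin padic_int.

Implicit Types x y z : padic_int.

Lemma expp_gt0 k : (0 < p ^ k)%N.
Proof. by rewrite expn_gt0 prime_gt0. Qed.

Lemma residue_lt x k : (x k < p ^ k)%N.
Proof. by case: x => x xP /=; have /asboolP/(_ k)[] := xP. Qed.

Lemma residue_small x k : (x k %% p ^ k)%N = x k.
Proof. by rewrite modn_small ?residue_lt. Qed.

Lemma residueS x k : (x k.+1 = x k %[mod p ^ k])%N.
Proof. by case: x => x xP /=; have /asboolP/(_ k)[] := xP. Qed.

Lemma residue_le x k m : (k <= m)%N -> (x m = x k %[mod p ^ k])%N.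
Proof.
move=> /subnK <-; elim: (m - k)%N => // d IH; rewrite addSn -IH.
have dv : (p ^ k %| p ^ (d + k))%N by rewrite dvdn_exp2l ?leq_addl.
by rewrite -(modn_dvdm _ dv) residueS modn_dvdm.
Qed.

Lemma padic_intP x y : (forall k, x k = y k) -> x = y.
Proof. by move=> xy; apply: val_inj; apply/funext. Qed.

Lemma reduce_subproof (f : nat -> nat) :
  (forall k, (f k.+1 = f k %[mod p ^ k])%N) ->
  `[< compatible (fun k => f k %% p ^ k)%N >].
Proof.
move=> fS; apply/asboolP => k; split; first by rewrite ltn_pmod ?expp_gt0.
by rewrite modn_mod modn_dvdm ?dvdn_exp2l ?fS.
Qed.

Definition reduce f (fS : forall k, (f k.+1 = f k %[mod p ^ k])%N) : padic_int :=
  PadicInt (reduce_subproof fS).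

Definition padic_int_nat (m : nat) : padic_int :=
  @reduce (fun=> m) (fun=> erefl).

Fact add_subproof x y k : (x k.+1 + y k.+1 = x k + y k %[mod p ^ k])%N.
Proof. by rewrite -modnDm !residueS modnDm. Qed.
Definition padic_int_add x y : padic_int := reduce (add_subproof x y).

Fact mul_subproof x y k : (x k.+1 * y k.+1 = x k * y k %[mod p ^ k])%N.
Proof. by rewrite -modnMm !residueS modnMm. Qed.
Definition padic_int_mul x y : padic_int := reduce (mul_subproof x y).

Fact opp_subproof x k :
  ((p ^ k.+1).-1 * x k.+1 = (p ^ k).-1 * x k %[mod p ^ k])%N.
Proof.
rewrite -modnMm residueS.
suff -> : ((p ^ k.+1).-1 = (p ^ k).-1 %[mod p ^ k])%N by rewrite modnMm.
have -> : (p ^ k.+1).-1 = ((p ^ k).-1 + p.-1 * p ^ k)%N.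
  rewrite expnS -{1}(prednK (prime_gt0 p_pr)) mulSn.
  by rewrite -{1}(prednK (expp_gt0 k)) addSn.
by rewrite addnC modnMDl.
Qed.
Definition padic_int_opp x : padic_int := reduce (opp_subproof x).

Fact padic_int_addA : associative padic_int_add.
Proof. by move=> x y z; apply: padic_intP => k /=; rewrite modnDmr modnDml addnA. Qed.
Fact padic_int_addC : commutative padic_int_add.
Proof. by move=> x y; apply: padic_intP => k /=; rewrite addnC. Qed.
Fact padic_int_add0 : left_id (padic_int_nat 0) padic_int_add.
Proof. by move=> x; apply: padic_intP => k /=; rewrite mod0n residue_small. Qed.
Fact padic_int_addN : left_inverse (padic_int_nat 0) padic_int_opp padic_int_add.
Proof.
move=> x; apply: padic_intP => k /=.
by rewrite modnDml mod0n addnC -mulSn prednK ?expp_gt0// modnMr.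
Qed.
HB.instance Definition _ := GRing.isZmodule.Build padic_int
  padic_int_addA padic_int_addC padic_int_add0 padic_int_addN.

Fact padic_int_mulA : associative padic_int_mul.
Proof. by move=> x y z; apply: padic_intP => k /=; rewrite modnMmr modnMml mulnA. Qed.
Fact padic_int_mulC : commutative padic_int_mul.
Proof. by move=> x y; apply: padic_intP => k /=; rewrite mulnC. Qed.
Fact padic_int_mul1 : left_id (padic_int_nat 1) padic_int_mul.
Proof.
by move=> x; apply: padic_intP => k /=; rewrite modnMml mul1n residue_small.
Qed.
Fact padic_int_mulDl : left_distributive padic_int_mul padic_int_add.
Proof.
by move=> x y z; apply: padic_intP => k /=; rewrite modnMml modnDm mulnDl.
Qed.
Fact padic_int_1neq0 : padic_int_nat 1 != padic_int_nat 0.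
Proof.
apply/eqP => /(congr1 (fun x : padic_int => x 1%N)) /=.
by rewrite expn1 mod0n modn_small ?prime_gt1.
Qed.
HB.instance Definition _ := GRing.Zmodule_isComNzRing.Build padic_int
  padic_int_mulA padic_int_mulC padic_int_mul1 padic_int_mulDl padic_int_1neq0.

Definition padic_int_unit : {pred padic_int} := fun x => `[< exists y, y * x = 1 >].
Definition padic_int_inv x : padic_int := xget x [set y | y * x = 1].

Fact padic_int_mulV : {in padic_int_unit, left_inverse 1 padic_int_inv *%R}.
Proof.
by move=> x /asboolP[y yx]; rewrite /padic_int_inv; case: xgetP => [z _ //|/(_ y)].
Qed.
Fact padic_int_unitP x y : y * x = 1 -> padic_int_unit x.
Proof. by move=> yx; apply/asboolP; exists y. Qed.
Fact padic_int_inv_out : {in [predC padic_int_unit], padic_int_inv =1 id}.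
Proof.
move=> x /negP xU; rewrite /padic_int_inv; case: xgetP => // y _ yx.
by case: xU; exact: padic_int_unitP yx.
Qed.
HB.instance Definition _ := GRing.ComNzRing_hasMulInverse.Build padic_int
  padic_int_mulV padic_int_unitP padic_int_inv_out.

Lemma padic_int_neq0P x : reflect (exists k, x k != 0%N) (x != 0).
Proof.
apply: (iffP idP) => [x0|[k]]; last first.
  by apply: contraNneq => ->; rewrite /= mod0n.
apply: contrapT => /forallNP h; move/eqP: x0; apply; apply: padic_intP => k.
by have /negP/negPn/eqP -> := h k; rewrite /= mod0n.
Qed.

Lemma residue_neq0 x k m : (k <= m)%N -> x k != 0%N -> x m != 0%N.
Proof.
move=> km; apply: contraNneq => xm.
by rewrite -residue_small -(residue_le x km) xm mod0n.
Qed.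

Lemma logn_residue x k m : (k <= m)%N -> x k != 0%N ->
  (logn p (x m) < k)%N /\ logn p (x m) = logn p (x k).
Proof.
move=> km xk; have xm := residue_neq0 km xk.
have dvd j : (j <= k)%N -> (p ^ j %| x m)%N = (p ^ j %| x k)%N.
  move=> jk; have dv : (p ^ j %| p ^ k)%N by rewrite dvdn_exp2l.
  by rewrite /dvdn -(modn_dvdm _ dv) (residue_le x km) modn_dvdm.
have ltk (y : nat) : y != 0%N -> ~~ (p ^ k %| y)%N -> (logn p y < k)%N.
  by move=> y0; rewrite pfactor_dvdn ?lt0n// -ltnNge.
have ndvd : ~~ (p ^ k %| x k)%N by rewrite /dvdn residue_small.
have lm : (logn p (x m) < k)%N by rewrite ltk ?dvd.
have lk : (logn p (x k) < k)%N by rewrite ltk.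
split=> //; apply/eqP; rewrite eqn_leq -!pfactor_dvdn ?lt0n//.
rewrite -(dvd _ (ltnW lm)) (dvd (logn p (x k))) ?(ltnW lk)//.
by rewrite !pfactor_dvdn ?lt0n ?leqnn.
Qed.

(* The p-adic valuation of x <> 0 is that of any nonzero residue x_k.          *)
Definition padic_int_abs x : rat :=
  if pselect (exists k, x k != 0%N) is left h
  then p%:R ^- logn p (x (ex_minn h)) else 0.

Lemma padic_int_absE x k : x k != 0%N -> padic_int_abs x = p%:R ^- logn p (x k).
Proof.
move=> xk; rewrite /padic_int_abs; case: pselect => [h|[]]; last by exists k.
by case: ex_minnP => j xj /(_ k xk) jk; rewrite (logn_residue jk xj).2.
Qed.

Lemma padic_int_abs0 : padic_int_abs 0 = 0.
Proof. 
rewrite /padic_int_abs; case: pselect => // h; exfalso.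
by case: h => k; rewrite /= mod0n.
Qed.

Lemma padic_int_mul_neq0 x y k l : x k != 0%N -> y l != 0%N ->
  residue (x * y) (k + l)%N != 0%N /\ logn p (residue (x * y) (k + l)%N) =
    (logn p (x (k + l)) + logn p (y (k + l)))%N.
Proof.
move=> xk yl; have km := leq_addr l k; have lm := leq_addl k l.
have xm := residue_neq0 km xk; have ym := residue_neq0 lm yl.
set m := (k + l)%N in km lm xm ym *.
have lx := (logn_residue km xk).1; have ly := (logn_residue lm yl).1.
have l_lt : (logn p (x m * y m) < m)%N.
  rewrite lognM ?lt0n// -addnS; exact: leq_add (ltnW lx) ly.
have xym0 : (0 < x m * y m)%N by rewrite muln_gt0 !lt0n xm.
have xy0 : residue (x * y) m != 0%N.
  by rewrite /= -/(dvdn _ _) pfactor_dvdn// -ltnNge.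
split=> //; rewrite -lognM ?lt0n//; apply/eqP.
have dvd j : (j <= m)%N -> (p ^ j %| residue (x * y)%R m)%N = (p ^ j %| x m * y m)%N.
  move=> jm; have dv : (p ^ j %| p ^ m)%N by rewrite dvdn_exp2l.
  by rewrite /dvdn /= modn_dvdm.
have l_lt' := (logn_residue (leqnn m) xy0).1.
rewrite eqn_leq -(pfactor_dvdn _ p_pr xym0) -pfactor_dvdn ?lt0n//.
rewrite -(dvd _ (ltnW l_lt')) (dvd (logn p (x m * y m))) ?(ltnW l_lt)//.
by rewrite !pfactor_dvdn ?leqnn ?lt0n ?xy0 -?lt0n ?xym0.
Qed.

Fact padic_int_idomain : GRing.integral_domain_axiom padic_int.
Proof.
move=> x y xy0; apply/norP => -[/padic_int_neq0P[k xk] /padic_int_neq0P[l yl]].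
by have [+ _] := padic_int_mul_neq0 xk yl; rewrite xy0 /= mod0n.
Qed.
HB.instance Definition _ :=
  GRing.ComUnitRing_isIntegral.Build padic_int padic_int_idomain.

Lemma padic_int_absM x y :
  padic_int_abs (x * y) = padic_int_abs x * padic_int_abs y.
Proof.
have [->|/padic_int_neq0P[k xk]] := eqVneq x 0.
  by rewrite !(mul0r, padic_int_abs0).
have [->|/padic_int_neq0P[l yl]] := eqVneq y 0.
  by rewrite !(mulr0, padic_int_abs0).
have [xy0 lxy] := padic_int_mul_neq0 xk yl.
rewrite (padic_int_absE xy0) lxy exprD invfM.
by rewrite -!padic_int_absE ?(residue_neq0 _ xk) ?(residue_neq0 _ yl) ?leq_addr ?leq_addl.
Qed.

Lemma padic_int_abs_neq0 x : x != 0 -> padic_int_abs x != 0.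
Proof.
move=> /padic_int_neq0P[k xk].
by rewrite (padic_int_absE xk) invr_neq0// expf_neq0// pnatr_eq0 -lt0n prime_gt0.
Qed.

Definition padic : fieldType := {fraction padic_int}.

(* The representative of a fraction is irrelevant by padic_abs_frac.           *)
Definition padic_abs (x : padic) : rat :=
  padic_int_abs (frac (repr x)).1 / padic_int_abs (frac (repr x)).2.

Lemma padic_abs_frac (a b : padic_int) : b != 0 ->
  padic_abs (tofrac a / tofrac b) = padic_int_abs a / padic_int_abs b.
Proof.
move=> b0; rewrite /padic_abs; set c := repr _.
have d0 : (frac c).2 != 0 by exact: denom_ratioP.
have tN x : x != 0 -> tofrac x != 0 :> padic by rewrite tofrac_eq0.
have cE : tofrac (frac c).1 / tofrac (frac c).2 = tofrac a / tofrac b :> padic.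
  rewrite -[RHS]reprK; apply: (mulIf (tN _ d0)); rewrite mulfVK ?tN//.
  move: d0; rewrite /c; move: (repr _) => r d0.
  unlock tofrac; rewrite -[RHS]FracField.pi_mul; apply/eqmodP => /=.
  by rewrite FracField.equivfE /FracField.mulf !numden_Ratio ?mulr1 ?mul1r ?oner_eq0// mulrC.
have := padic_int_absM a (frac c).2.
have -> : a * (frac c).2 = (frac c).1 * b.
  apply/eqP; rewrite -tofrac_eq !tofracM.
  by rewrite -[_ == _](eqr_div _ _ (tN _ b0) (tN _ d0)) cE.
rewrite padic_int_absM => e.
by apply/eqP; rewrite eqr_div ?padic_int_abs_neq0// e.
Qed.

End PadicIntegers.

Section PadicSpace.
Variables (p : nat) (p_pr : prime p) (n : nat).

Definition padic_space := 'rV[padic p_pr]_n.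

Definition padic_norm (x : padic_space) : rat :=
  \big[Num.max/0]_(i < n) padic_abs (x ord0 i).

Definition padic_open : set (set padic_space) :=
  [set U | forall x, U x -> exists2 e, 0 < e &
    forall y, padic_norm (y - x) < e -> U y].

HB.instance Definition _ := GRing.Lmodule.on padic_space.
HB.instance Definition _ := isPointed.Build padic_space 0.
HB.instance Definition _ :=
  Measurable.copy padic_space (g_sigma_algebraType padic_open).

End PadicSpace.

Section HausdorffLorentz.
Variables (R : realType) (p : nat) (p_pr : prime p) (n : nat).
Local Notation V := (padic_space p_pr n).
Variable mu : {measure set V -> \bar R}.

(* Any translation-invariant Borel measure normalized on the unit ball is      *)
(* locally finite, hence the Haar measure.                                     *)
Definition is_haar : Prop :=
  (forall (a : V) (A : set V), measurable A ->
     mu [set a + x | x in A] = mu A) /\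
  mu [set x : V | padic_norm x <= 1] = 1%E.

Definition padic_normR (x : V) : R := ratr (padic_norm x).

Definition power_weight (a : R) (x : V) : R := padic_normR x `^ a.

(* Measurability with respect to the completion of mu. The library integral is *)
(* a supremum over Borel simple functions, so on such functions it agrees with *)
(* the integral against the completion.                                        *)
Definition ae_measurable (f : V -> R[i]) : Prop :=
  exists g : V -> R[i],
    [/\ measurable_fun setT (fun x => complex.Re (g x)),
        measurable_fun setT (fun x => complex.Im (g x)) &
        {ae mu, forall x, f x = g x}].

Definition cintegral (f : V -> R[i]) : R[i] :=
  Complex (Rintegral mu setT (fun x => complex.Re (f x)))
          (Rintegral mu setT (fun x => complex.Im (f x))).

(* ratr (padic_norm y) is |y|_p seen in Q_p and padic_normR y is |y|_p in R.   *)
Definition hausdorff_integrand (Phi : V -> R[i]) (beta : R) (f : V -> R[i])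
    (x y : V) : R[i] :=
  Phi (ratr (padic_norm y) *: x) /
    real_complex R (padic_normR y `^ (n%:R - beta)) * f y.

Definition hausdorff Phi beta f (x : V) : R[i] :=
  cintegral (hausdorff_integrand Phi beta f x).

Definition hausdorff_converges Phi beta f (x : V) : Prop :=
  (\int[mu]_y (Normc.normc (hausdorff_integrand Phi beta f x y))%:E < +oo)%E.

Definition weighted_distribution (w : V -> R) (f : V -> R[i]) (l : R) : \bar R :=
  (\int[mu]_(x in [set x | (l < Normc.normc (f x))%R]) (w x)%:E)%E.

Definition weighted_rearrangement w f (t : R) : \bar R :=
  ereal_inf [set l%:E | l in
    [set l : R | 0 < l /\ (weighted_distribution w f l <= t%:E)%E]].

Definition lorentz_norm (q s : R) w f : \bar R :=
  (((s / q)%:E * \int[lebesgue_measure]_(t in `]0%R, +oo[)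
      (((t `^ q^-1)%:E * weighted_rearrangement w f t) `^ s * (t^-1)%:E))
    `^ (s^-1))%E.

Definition in_lorentz (q s : R) w f : Prop :=
  ae_measurable f /\ (lorentz_norm q s w f < +oo)%E.

End HausdorffLorentz.

(* Main.v *)
Require Import Defs.
From mathcomp Require Import all_boot all_order all_algebra fraction.
From mathcomp Require Import all_classical all_reals all_analysis.
From mathcomp Require Import measurable_realfun complex.
From mathcomp Require Import zify ring lra.
Set Implicit Arguments.
Unset Strict Implicit.
Unset Printing Implicit Defensive.
Import Order.TTheory GRing.Theory Num.Theory.
Import numFieldNormedType.Exports.
Local Open Scope classical_set_scope.
Local Open Scope ring_scope.

(** The operator is estimated level by level on spheres.  Write
    A = n + alpha and B = n + gamma, so that the scaling relation reads
    A/q - beta = B/r, and let S_j be the sphere |y| = p^j.  Since Phi is radial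
    and the norm of x|y| is |x|/|y|, the function H f is radial, and for |x| = p^m
      |H f(x)| <= 2 sum_j |psi(p^(m-j))| p^(-(n-beta)j) int_{S_j} |f|.
    After multiplication by p^(mB/r) the right-hand side is a convolution over
    the integers of k |-> |psi(p^k)| p^(kB/r) with
    j |-> p^(jA/q) p^(-jn) int_{S_j} |f|.

    The two integrability conditions say that |psi(p^k)| p^(k(A/u - beta)) is
    bounded in k for u = q - eps and u = q + eps.  The exponents A/u - beta lie
    on both sides of B/r, so the convolution kernel decays geometrically in
    both directions ([profile_decay]).  The two other operations of the proof
    also have geometric kernels.  Bounding the average of |f| on S_j by the
    values a_i = p^(iA/q) f^*(p^(iA)) of the rearrangement, i <= j, costs the
    ratio p^(A/q - A) < 1, because q > 1 ([integral_sphere_le]); bounding the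
    rearrangement of a radial function by its values on spheres costs the ratio
    p^(-B/r) < 1 ([radial_lorentz_le]).

    A geometric kernel acts trivially on a slowly varying sequence, that is,
    one satisfying e_i <= p^(d|i-j|) e_j with d smaller than the decay rate: it
    multiplies e_j by a constant at most.  Any sequence a with a^s summable has a
    slowly varying majorant whose s-th powers have a comparable sum
    ([envelope]).  Replacing a by such a majorant e at the start, all three
    operations become pointwise bounds, and |H f| <= C p^(-mB/r) e_m on S_m.
    Both Lorentz norms are compared with sums over the integers by cutting the
    half-line into the intervals [c x^k, c x^(k+1)[ ([lorentz_integral_ge],
    [lorentz_integral_le]), which gives the theorem.

    The function f agrees only almost everywhere with a Borel function, and its
    superlevel sets need not be Borel.  The comparison of integrals
    [ge0_le_integral_null] covers this case. *)

(** * The p-adic absolute value *)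

Section PadicAbsoluteValue.
Variables (p : nat) (p_pr : prime p).
Local Notation Zp := (Defs_padic_int__canonical__GRing_IntegralDomain p_pr).
Local Notation Qp := (padic p_pr).
Local Notation P := (p%:R : rat).

Let P0 : 0 < P. Proof. by rewrite ltr0n prime_gt0. Qed.
Let P1 : 1 < P. Proof. by rewrite ltr1n prime_gt1. Qed.

(** Through this equivalence the ultrametric inequality and the estimates on
    digits become statements about residues modulo p^k. *)
Lemma padic_int_abs_le (x : Zp) k :
  (padic_int_abs x <= P ^- k) = (residue x k == 0%N).
Proof.
have [->|/padic_int_neq0P[m xm]] := eqVneq x 0.
  by rewrite padic_int_abs0 invr_ge0 exprn_ge0 ?(ltW P0)//= mod0n eqxx.
rewrite (padic_int_absE p_pr xm) lef_pV2 ?posrE ?exprn_gt0//.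
rewrite ler_eXn2l//.
have [xk|xk] := eqVneq (residue x k) 0%N; last first.
  apply/negbTE; rewrite -ltnNge.
  have [km|mk] := leqP k m.
    by have [lt_m eq_m] := logn_residue p_pr km xk; rewrite eq_m -eq_m.
  have [lt_m eq_m] := logn_residue p_pr (ltnW mk) xm.
  by rewrite -eq_m; have [+ _] := logn_residue p_pr (leqnn k) xk.
rewrite -pfactor_dvdn ?lt0n//.
have km : (k <= m)%N.
  rewrite leqNgt; apply/negP => mk.
  by have := residue_neq0 (ltnW mk) xm; rewrite xk.
by rewrite /dvdn (residue_le _ km) xk mod0n.
Qed.

Lemma padic_int_abs_ge0 (x : Zp) : 0 <= padic_int_abs x.
Proof.
have [->|/padic_int_neq0P[m xm]] := eqVneq x 0; first by rewrite padic_int_abs0.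
by rewrite (padic_int_absE p_pr xm) invr_ge0 exprn_ge0 ?(ltW P0).
Qed.

Lemma padic_int_abs_val (x : Zp) : x != 0 ->
  exists k : nat, padic_int_abs x = P ^- k.
Proof.
by move=> /padic_int_neq0P[m xm]; exists (logn p (residue x m)); exact: padic_int_absE.
Qed.

Lemma padic_int_abs_add (x y : Zp) e :
  padic_int_abs x <= e -> padic_int_abs y <= e -> padic_int_abs (x + y) <= e.
Proof.
wlog xy : x y / padic_int_abs y <= padic_int_abs x => [hw|] xe ye.
  have [yx|/ltW xy] := leP (padic_int_abs y) (padic_int_abs x).
    by apply: hw.
  by rewrite addrC; apply: hw.
have [x0|x0] := eqVneq x 0.
  move: xy; rewrite x0 padic_int_abs0 add0r => y0; apply: (le_trans y0).
  by apply: le_trans xe; exact: padic_int_abs_ge0.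
have [k xk] := padic_int_abs_val x0; apply: le_trans xe; rewrite xk.
move: xy; rewrite xk (padic_int_abs_le y) => /eqP yk.
have : padic_int_abs x <= P ^- k by rewrite xk.
by rewrite padic_int_abs_le => /eqP xk0; rewrite padic_int_abs_le /= xk0 yk mod0n.
Qed.

Lemma padic_int_abs_gt0 (x : Zp) : x != 0 -> 0 < padic_int_abs x.
Proof. by move=> x0; rewrite lt_def padic_int_abs_neq0// padic_int_abs_ge0. Qed.


Lemma padic_fracP (x : Qp) : exists a b : Zp,
  b != 0 /\ x = tofrac a / tofrac b.
Proof.
exists (frac (repr x)).1, (frac (repr x)).2.
have d0 : (frac (repr x)).2 != 0 :> Zp by exact: denom_ratioP.
split=> //.
have dF0 : tofrac ((frac (repr x)).2 : Zp) != 0 :> Qp by rewrite tofrac_eq0.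
apply: (mulIf dF0); rewrite mulfVK// -{1}[x]reprK.
move: d0 {dF0}; move: (repr x) => r d0.
unlock tofrac; rewrite -[LHS]FracField.pi_mul; apply/eqmodP => /=.
by rewrite FracField.equivfE /FracField.mulf !numden_Ratio ?mulr1 ?oner_eq0// mulrC.
Qed.

Lemma padic_abs_tofrac (a : Zp) : padic_abs (tofrac a : Qp) = padic_int_abs a.
Proof.
have o0 : (1 : Zp) != 0 by rewrite oner_eq0.
have := padic_abs_frac a o0; rewrite tofrac1 divr1 => ->.
have [m Em] := padic_int_abs_val o0.
have : padic_int_abs (1 * 1 : Zp) = padic_int_abs (1 : Zp) * padic_int_abs (1 : Zp).
  exact: padic_int_absM.
rewrite mulr1 -{1}[padic_int_abs (1 : Zp)]mulr1.
move/(mulfI (lt0r_neq0 (padic_int_abs_gt0 o0))) => <-.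
by rewrite divr1.
Qed.

Lemma padic_abs0 : padic_abs (0 : Qp) = 0.
Proof. by rewrite -tofrac0 padic_abs_tofrac padic_int_abs0. Qed.

Lemma padic_abs_ge0 (x : Qp) : 0 <= padic_abs x.
Proof.
have [a [b [b0 ->]]] := padic_fracP x.
by rewrite padic_abs_frac// divr_ge0 ?padic_int_abs_ge0.
Qed.

Lemma padic_absM (x y : Qp) : padic_abs (x * y) = padic_abs x * padic_abs y.
Proof.
have [a [b [b0 ->]]] := padic_fracP x; have [c [d [d0 ->]]] := padic_fracP y.
rewrite mulf_div -!tofracM !padic_abs_frac ?mulf_neq0//.
by rewrite !padic_int_absM// mulf_div.
Qed.

Lemma padic_abs_val (x : Qp) : x != 0 -> exists k : int, padic_abs x = P ^ k.
Proof.
have [a [b [b0 ->]]] := padic_fracP x.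
have [->|a0 _] := eqVneq a 0; first by rewrite tofrac0 mul0r eqxx.
rewrite padic_abs_frac//.
have [k ->] := padic_int_abs_val a0; have [l ->] := padic_int_abs_val b0.
exists (l%:Z - k%:Z); rewrite expfzDr ?gt_eqF// invrK mulrC.
by rewrite -exprnP -exprnN.
Qed.

Lemma padic_abs_eq0 (x : Qp) : (padic_abs x == 0) = (x == 0).
Proof.
apply/idP/idP => [|/eqP ->]; last by rewrite padic_abs0.
apply: contraTT => /padic_abs_val[k ->].
by rewrite expfz_neq0// gt_eqF.
Qed.

Lemma padic_abs_add (x y : Qp) e :
  padic_abs x <= e -> padic_abs y <= e -> padic_abs (x + y) <= e.
Proof.
have [a [b [b0 ->]]] := padic_fracP x; have [c [d [d0 ->]]] := padic_fracP y.
rewrite addf_div ?tofrac_eq0// -!tofracM -tofracD !padic_abs_frac ?mulf_neq0//.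
rewrite padic_int_absM//.
have B := padic_int_abs_gt0 b0; have D := padic_int_abs_gt0 d0.
rewrite !ler_pdivrMr ?mulr_gt0// => ab cd.
apply: padic_int_abs_add; rewrite padic_int_absM//.
  by rewrite mulrA ler_wpM2r// ltW.
by rewrite (mulrC (padic_int_abs b)) mulrA ler_wpM2r// ltW.
Qed.

Lemma padic_int_residue_nat c k : residue (c%:R : Zp) k = (c %% p ^ k)%N.
Proof.
elim: c => [|c IH] /=; first by rewrite mod0n.
by rewrite -addn1 natrD /= IH /= modnDm.
Qed.

Lemma padic_abs_nat_le1 c : padic_abs (c%:R : Qp) <= 1.
Proof.
rewrite -tofrac1 -tofracMn padic_abs_tofrac.
by rewrite -[leRHS]invr1 -(expr0 P) padic_int_abs_le padic_int_residue_nat modn1.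
Qed.

Lemma padic_absN (x : Qp) : padic_abs (- x) = padic_abs x.
Proof.
have abs1 : padic_abs (1 : Qp) = 1.
  have /eqP := padic_absM 1 1; rewrite mulr1 -{1}[padic_abs _]mulr1.
  by rewrite (inj_eq (mulfI _)) ?padic_abs_eq0 ?oner_eq0// => /eqP.
have : padic_abs (- 1 : Qp) ^+ 2 = 1 by rewrite expr2 -padic_absM mulrNN mulr1.
move/eqP; rewrite sqrf_eq1 => /orP[|] /eqP N1; last first.
  by have := padic_abs_ge0 (-1); rewrite N1.
by rewrite -mulN1r padic_absM N1 mul1r.
Qed.

Lemma padic_abs_p : padic_abs (p%:R : Qp) = P^-1.
Proof.
apply/eqP; rewrite eq_le -tofrac1 -tofracMn padic_abs_tofrac; apply/andP; split.
  by rewrite -[P]expr1 padic_int_abs_le padic_int_residue_nat expn1 modnn.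
have n2 : residue (p%:R : Zp) 2 != 0%N.
  rewrite padic_int_residue_nat modn_small -?lt0n ?prime_gt0//.
  by rewrite -{1}[p]expn1 ltn_exp2l// prime_gt1.
rewrite (padic_int_absE p_pr n2) lef_pV2 ?posrE ?exprn_gt0// -[leRHS]expr1.
rewrite ler_eXn2l// padic_int_residue_nat modn_small; last first.
  by rewrite -{1}[p]expn1 ltn_exp2l// prime_gt1.
by rewrite logn_prime// eqxx.
Qed.

Lemma padic_abs_pX (k : int) : padic_abs ((p%:R : Qp) ^ k) = P ^ (- k).
Proof.
have nat_case (m : nat) : padic_abs ((p%:R : Qp) ^+ m) = P ^- m.
  elim: m => [|m IH]; last first.
    by rewrite exprS padic_absM IH padic_abs_p -invfM -exprS.
  rewrite !expr0 invr1; have /eqP := padic_absM 1 1; rewrite mulr1 -{1}[padic_abs _]mulr1.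
  by rewrite (inj_eq (mulfI _)) ?padic_abs_eq0 ?oner_eq0// => /eqP.
have p0 : (p%:R : Qp) != 0.
  by rewrite -padic_abs_eq0 padic_abs_p invr_eq0 gt_eqF.
case: k => m; first by rewrite -exprnP nat_case exprnN.
rewrite NegzE opprK -exprnN -exprnP.
apply: (mulfI (lt0r_neq0 (_ : 0 < P ^- m.+1))); first by rewrite invr_gt0 exprn_gt0.
rewrite mulVf ?expf_neq0 ?gt_eqF// -nat_case -padic_absM mulfV ?expf_neq0//.
by have := nat_case 0%N; rewrite !expr0 invr1.
Qed.

(** Write x = a/b with |b| = p^-v.  Then a and b are divisible by p^v, and
    modulo p^(v+1) they are a1 p^v and b1 p^v with b1 prime to p; the digit c
    solves a1 + c b1 = 0 in the field with p elements. *)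
Lemma padic_digit_ex (x : Qp) : padic_abs x <= 1 ->
  exists c : 'I_p, padic_abs (x + c%:R) <= P^-1.
Proof.
have [a [b [b0 ->]]] := padic_fracP x; rewrite padic_abs_frac//.
have B := padic_int_abs_gt0 b0; rewrite ler_pdivrMr// mul1r.
have [v Ev] := padic_int_abs_val b0; rewrite Ev padic_int_abs_le => /eqP av.
have bv : residue b v = 0%N by apply/eqP; rewrite -padic_int_abs_le Ev.
have bv1 : residue b v.+1 != 0%N.
  by rewrite -padic_int_abs_le Ev lef_pV2 ?posrE ?exprn_gt0// ler_eXn2l// ltnn.
have /dvdnP[b1 Eb] : (p ^ v %| residue b v.+1)%N by rewrite /dvdn residueS bv mod0n.
have /dvdnP[a1 Ea] : (p ^ v %| residue a v.+1)%N by rewrite /dvdn residueS av mod0n.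
have b1p : (b1%:R : 'F_p) != 0.
  rewrite -(dvdn_pcharf (pchar_Fp p_pr)); apply/negP => /dvdnP[d Ed].
  have := residue_lt b v.+1; rewrite Eb Ed -mulnA -expnS => lt.
  have d0 : d = 0%N.
    by move: lt; rewrite -{2}[(p ^ v.+1)%N]mul1n ltn_pmul2r ?expp_gt0//; lia.
  by move: bv1; rewrite Eb Ed d0.
have [c cE] : exists c : 'F_p, c * b1%:R = - a1%:R.
  by exists (- a1%:R / b1%:R); rewrite mulfVK.
have cp : (c < p)%N by have := ltn_ord c; rewrite [X in (_ < X)%N -> _]Fp_cast.
exists (Ordinal cp) => /=.
have -> : tofrac a / tofrac b + c%:R = tofrac (a + c%:R * b) / tofrac b :> Qp.
  by rewrite tofracD tofracM tofracMn tofrac1 mulrDl mulfK ?tofrac_eq0.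
rewrite padic_abs_frac// Ev ler_pdivrMr ?invr_gt0 ?exprn_gt0// -invfM -exprS.
rewrite padic_int_abs_le /= padic_int_residue_nat modnMml modnDmr.
rewrite Ea Eb mulnA -mulnDl expnS -/(dvdn _ _) dvdn_pmul2r ?expp_gt0//.
rewrite (dvdn_pcharf (pchar_Fp p_pr)) natrD natrM.
have -> : ((c : nat)%:R : 'F_p) = c by rewrite natr_Zp.
by rewrite cE subrr.
Qed.

Lemma padic_digit_inj (c d : 'I_p) :
  padic_abs (c%:R - d%:R : Qp) <= P^-1 -> c = d.
Proof.
wlog dc : c d / (d <= c)%N => [hw|].
  have [dc|/ltnW cd] := leqP d c; first exact: hw.
  by rewrite -opprB padic_absN => /hw -> .
rewrite -natrB// -tofrac1 -tofracMn padic_abs_tofrac -[P]expr1 padic_int_abs_le.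
rewrite padic_int_residue_nat expn1 modn_small; last first.
  by apply: leq_ltn_trans (leq_subr _ _) (ltn_ord _).
by rewrite subn_eq0 => cd; apply/val_inj/eqP; rewrite eqn_leq cd.
Qed.

(** In [hausdorff_integrand] the rational |y| is cast into Q_p; this is where
    multiplication by |y| is seen to divide the norm by |y|. *)
Lemma ratr_pX (k : int) : ratr (P ^ k) = (p%:R : Qp) ^ k.
Proof.
have p0 : (p%:R : Qp) != 0.
  by rewrite -padic_abs_eq0 padic_abs_p invr_eq0 gt_eqF.
case: k => m.
  rewrite -!exprnP -natrX -[(p ^ m)%:R]/((p ^ m)%:Z%:~R) /ratr numq_int denq_int.
  by rewrite divr1 -pmulrn natrX.
rewrite NegzE -!exprnN -natrX /ratr.
have pm : (p ^ m.+1)%:R^-1 = 1%:~R / (p ^ m.+1)%:Z%:~R :> rat by rewrite div1r.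
have cop : coprime `|1%Z| `|(p ^ m.+1)%:Z| by rewrite /= coprime1n.
have sg1 : Num.sg (p ^ m.+1)%:Z = 1 by rewrite gtr0_sg// ltz_nat expp_gt0.
rewrite pm coprimeq_num// coprimeq_den// sg1 mulr1.
rewrite gt_eqF ?ltz_nat ?expp_gt0//.
by rewrite mul1r /= -pmulrn natrX.
Qed.

End PadicAbsoluteValue.

(** * Balls and spheres of the p-adic space *)

Section PadicSpaceGeometry.
Variables (p : nat) (p_pr : prime p) (n : nat).
Local Notation V := (padic_space p_pr n).
Local Notation P := (p%:R : rat).

Let P0 : 0 < P. Proof. by rewrite ltr0n prime_gt0. Qed.
Let P1 : 1 < P. Proof. by rewrite ltr1n prime_gt1. Qed.

Lemma padic_norm_leP (x : V) e :
  reflect (0 <= e /\ forall i, padic_abs (x ord0 i) <= e) (padic_norm x <= e).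
Proof.
rewrite /padic_norm; apply: (iffP (bigmax_leP _ _ _ _)) => -[e0 h]; split=> // i.
by apply: h.
Qed.

Lemma padic_norm_ge0 (x : V) : 0 <= padic_norm x.
Proof. exact: bigmax_ge_id. Qed.

Lemma padic_norm_coord (x : V) i : padic_abs (x ord0 i) <= padic_norm x.
Proof. by have /padic_norm_leP[_] := lexx (padic_norm x); apply. Qed.

Lemma padic_norm_add (x y : V) e :
  padic_norm x <= e -> padic_norm y <= e -> padic_norm (x + y) <= e.
Proof.
move=> /padic_norm_leP[e0 xe] /padic_norm_leP[_ ye]; apply/padic_norm_leP.
by split=> // i; rewrite mxE padic_abs_add.
Qed.

Lemma padic_normN (x : V) : padic_norm (- x) = padic_norm x.
Proof. by apply: eq_bigr => i _; rewrite mxE padic_absN. Qed.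

Lemma padic_norm_sub (x y : V) e :
  padic_norm x <= e -> padic_norm y <= e -> padic_norm (x - y) <= e.
Proof. by move=> xe ye; rewrite padic_norm_add ?padic_normN. Qed.

Lemma padic_normZ c (x : V) : padic_norm (c *: x) = padic_abs c * padic_norm x.
Proof.
apply/eqP; rewrite eq_le; apply/andP; split.
  apply/padic_norm_leP; split=> [|i].
    by rewrite mulr_ge0 ?padic_abs_ge0 ?padic_norm_ge0.
  by rewrite mxE padic_absM ler_wpM2l ?padic_abs_ge0 ?padic_norm_coord.
have [->|c0] := eqVneq c 0; first by rewrite padic_abs0 mul0r padic_norm_ge0.
have ac : 0 < padic_abs c by rewrite lt_def padic_abs_eq0 c0 padic_abs_ge0.
rewrite -ler_pdivlMl//; apply/padic_norm_leP; split=> [|i].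
  by rewrite mulr_ge0 ?invr_ge0 ?padic_abs_ge0 ?padic_norm_ge0.
by rewrite ler_pdivlMl// -padic_absM; have := padic_norm_coord (c *: x) i; rewrite mxE.
Qed.

Lemma padic_norm_eq0 (x : V) : (padic_norm x == 0) = (x == 0).
Proof.
apply/idP/eqP => [/eqP x0|->]; last first.
  by rewrite -(scale0r (0 : V)) padic_normZ padic_abs0 mul0r.
apply/rowP => i; rewrite mxE; apply/eqP; rewrite -padic_abs_eq0 eq_le.
by rewrite padic_abs_ge0 andbT -x0 padic_norm_coord.
Qed.

Lemma padic_norm0 : padic_norm (0 : V) = 0.
Proof. by apply/eqP; rewrite padic_norm_eq0. Qed.

Lemma padic_norm_val (x : V) : x != 0 -> exists k : int, padic_norm x = P ^ k.
Proof.
rewrite -padic_norm_eq0.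
have : padic_norm x = 0 \/ exists k : int, padic_norm x = P ^ k.
  rewrite /padic_norm; apply: (big_ind (fun y => y = 0 \/ exists k, y = P ^ k)).
  - by left.
  - by move=> y z hy hz; case: (leP y z).
  - move=> i _; have [->|/padic_abs_val] := eqVneq (x ord0 i) 0.
      by left; rewrite padic_abs0.
    by right.
by move=> [->|//]; rewrite eqxx.
Qed.

(** If |y| were smaller than |x|, then x = y - (y - x) would have norm below |x|. *)
Lemma padic_norm_near (x y : V) :
  padic_norm (y - x) < padic_norm x -> padic_norm y = padic_norm x.
Proof.
move=> yx; apply/eqP; rewrite eq_le; apply/andP; split.
  by rewrite -(subrK x y) padic_norm_add// ltW.
rewrite leNgt; apply/negP => lt.
suff : padic_norm x < padic_norm x by rewrite ltxx.
rewrite -{1}(subKr y x).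
apply: le_lt_trans (_ : Num.max (padic_norm y) (padic_norm (y - x)) < _).
  by apply: padic_norm_sub; rewrite le_max lexx ?orbT.
by rewrite gt_max lt.
Qed.

Lemma measurable_padic_open (U : set V) : padic_open U -> measurable U.
Proof. exact: sub_sigma_algebra. Qed.

(** By [padic_norm_near] such a set is open once the origin is removed, and the
    origin is the complement of an open set. *)
Lemma measurable_norm_set (A : set rat) : measurable [set x : V | A (padic_norm x)].
Proof.
have opn (B : set rat) : measurable [set x : V | x != 0 /\ B (padic_norm x)].
  apply: measurable_padic_open => x [x0 Ax].
  exists (padic_norm x).
    by rewrite lt_def padic_norm_eq0 x0 padic_norm_ge0.
  move=> y /padic_norm_near yx; split; last by rewrite yx.
  by rewrite -padic_norm_eq0 yx padic_norm_eq0.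
have [A0|A0] := pselect (A 0).
  suff -> : [set x : V | A (padic_norm x)] =
      [set x : V | x != 0 /\ A (padic_norm x)] `|`
      ~` [set x : V | x != 0 /\ [set: rat] (padic_norm x)].
    by apply: measurableU; [|apply: measurableC].
  apply/seteqP; split=> x /=.
    move=> Ax; have [->|x0] := eqVneq x 0; last by left.
    by right => -[].
  move=> [[]//|]; have [-> _|x0 []] := eqVneq x 0; last by [].
  by rewrite padic_norm0.
suff -> : [set x : V | A (padic_norm x)] =
      [set x : V | x != 0 /\ A (padic_norm x)] by [].
apply/seteqP; split=> x /= => [Ax|[]//].
by split=> //; apply/eqP => x0; move: Ax; rewrite x0 padic_norm0.
Qed.

Definition padic_ball (k : int) : set V := [set x | padic_norm x <= P ^ k].
Definition padic_sphere (k : int) : set V := [set x | padic_norm x = P ^ k].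

Lemma measurable_padic_zero : measurable [set 0 : V].
Proof.
have -> : [set 0 : V] = [set x : V | padic_norm x = 0].
  apply/seteqP; split=> x /= => [->|/eqP]; rewrite ?padic_norm0//.
  by rewrite padic_norm_eq0 => /eqP.
exact: (measurable_norm_set [set 0]).
Qed.

Lemma measurable_padic_ball k : measurable (padic_ball k).
Proof. exact: (measurable_norm_set [set t | t <= P ^ k]). Qed.

Lemma measurable_padic_sphere k : measurable (padic_sphere k).
Proof. exact: (measurable_norm_set [set t | t = P ^ k]). Qed.

Lemma padic_ball_translateE (a : V) k :
  [set a + x | x in padic_ball k] = [set x | padic_norm (x - a) <= P ^ k].
Proof.
apply/seteqP; split=> x /=.
  by move=> [y yk <-]; rewrite addrC addKr.
by move=> xa; exists (x - a) => //; rewrite addrC subrK.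
Qed.

Lemma measurable_padic_ball_translate (a : V) k :
  measurable [set a + x | x in padic_ball k].
Proof.
rewrite padic_ball_translateE; apply: measurable_padic_open => x /= xa.
exists (P ^ k); first exact: exprz_gt0.
move=> y yx; rewrite -(subrK x y) -addrA.
by apply: padic_norm_add => //; exact: ltW.
Qed.

(** Centres of the p^n balls of radius p^(k-1) that tile the ball of radius
    p^k.  The sign agrees with the one chosen in [padic_digit_ex]. *)
Definition padic_digits (k : int) (c : {ffun 'I_n -> 'I_p}) : V :=
  \row_i (- ((c i)%:R * p%:R ^ (- k))).

Let pN0 : (p%:R : padic p_pr) != 0.
Proof. by rewrite -padic_abs_eq0 padic_abs_p invr_eq0 gt_eqF. Qed.

Lemma padic_digits_inj k c d :
  padic_norm (padic_digits (k + 1) c - padic_digits (k + 1) d) <= P ^ k -> c = d.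
Proof.
move=> /padic_norm_leP[_ cd]; apply/ffunP => i; apply: (@padic_digit_inj _ p_pr).
have := cd i; rewrite !mxE -opprD padic_absN -mulrBl padic_absM padic_abs_pX opprK.
rewrite expfzDr ?gt_eqF// expr1z mulrCA -[leRHS]mulr1 ler_pM2l ?exprz_gt0//.
by rewrite -ler_pdivlMr// mul1r.
Qed.

Lemma padic_digits_ex k (x : V) : padic_ball (k + 1) x ->
  exists c, padic_norm (x - padic_digits (k + 1) c) <= P ^ k.
Proof.
move=> /padic_norm_leP[_ xk].
have ex i : exists c : 'I_p, padic_abs (x ord0 i * p%:R ^ (k + 1) + c%:R) <= P^-1.
  apply: padic_digit_ex; rewrite padic_absM padic_abs_pX -ler_pdivlMr ?exprz_gt0//.
  by rewrite mul1r -invr_expz invrK.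
exists [ffun i => sval (cid (ex i))]; apply/padic_norm_leP; split=> [|i].
  exact: exprz_ge0.
rewrite !mxE ffunE; case: cid => c /= cP; rewrite opprK.
have -> : x ord0 i + c%:R * p%:R ^ (- (k + 1)) =
    (x ord0 i * p%:R ^ (k + 1) + c%:R) * p%:R ^ (- (k + 1)).
  by rewrite mulrDl -mulrA -expfzDr// subrr expr0z mulr1.
rewrite padic_absM padic_abs_pX opprK.
have -> : P ^ k = P^-1 * P ^ (k + 1).
  by rewrite expfzDr ?gt_eqF// expr1z mulrCA mulVf ?gt_eqF// mulr1.
by rewrite ler_wpM2r// exprz_ge0.
Qed.

Lemma padic_ball_split k : padic_ball (k + 1) =
  \bigcup_(c in [set: {ffun 'I_n -> 'I_p}])
    [set padic_digits (k + 1) c + x | x in padic_ball k].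
Proof.
under eq_bigcupr do rewrite padic_ball_translateE.
apply/seteqP; split=> x /=.
  by move=> /padic_digits_ex[c xc]; exists c.
move=> [c _ /= xc]; rewrite /padic_ball/= -(subrK (padic_digits (k + 1) c) x).
apply: padic_norm_add.
  by apply: le_trans xc _; rewrite ler_eXz2l// lerDl.
apply/padic_norm_leP; split=> [|i]; first exact: exprz_ge0.
rewrite mxE padic_absN padic_absM padic_abs_pX opprK ler_piMl ?exprz_ge0//.
exact: padic_abs_nat_le1.
Qed.

Lemma padic_digits_trivIset k :
  trivIset setT (fun c : {ffun 'I_n -> 'I_p} =>
    [set padic_digits (k + 1) c + x | x in padic_ball k]).
Proof.
move=> c d _ _ [x []].
rewrite -[X in X -> _]/([set padic_digits (k + 1) c + x | x in padic_ball k] x).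
rewrite -[X in _ -> X -> _]/([set padic_digits (k + 1) d + x | x in padic_ball k] x).
rewrite !padic_ball_translateE => /= xc xd.
apply: (@padic_digits_inj k); have -> : padic_digits (k + 1) c - padic_digits (k + 1) d =
  (x - padic_digits (k + 1) d) - (x - padic_digits (k + 1) c) by rewrite opprB [RHS]addrC addrA subrK.
exact: (padic_norm_sub xd xc).
Qed.

End PadicSpaceGeometry.

(** * Haar measure of balls and spheres *)

Section HaarMeasureOfBalls.
Variables (R : realType) (p : nat) (p_pr : prime p) (n : nat).
Local Notation V := (padic_space p_pr n).
Variable mu : {measure set V -> \bar R}.
Hypothesis haar : is_haar mu.

Lemma haar_ballS k :
  mu (padic_ball (k + 1)) = ((p ^ n)%:R%:E * mu (padic_ball k))%E.
Proof.
rewrite padic_ball_split -fsbig_setU; last exact: finite_finset.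
rewrite measure_fsbig/=; last 3 first.
- exact: finite_finset.
- by move=> c _; exact: measurable_padic_ball_translate.
- exact: padic_digits_trivIset.
under eq_fsbigr do rewrite (haar.1 _ _ (@measurable_padic_ball _ _ _ _)).
have -> : [set: {ffun 'I_n -> 'I_p}] = [set` enum {ffun 'I_n -> 'I_p}].
  by apply/seteqP; split=> c //= _; rewrite mem_enum.
rewrite -fsbig_seq ?enum_uniq// big_enum/= sumr_const card_ffun !card_ord.
elim: (p ^ n)%N => [|m IH]; first by rewrite mul0e mulr0n.
by rewrite mulrSr IH -addn1 natrD EFinD ge0_muleDl ?lee_fin// mul1e.
Qed.

Local Notation N := ((p ^ n)%:R : R).

Lemma haar_ball k : mu (padic_ball k) = (N ^ k)%:E.
Proof.
have N0 : 0 < N by rewrite ltr0n expp_gt0.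
have base : mu (padic_ball 0) = 1%E by exact: haar.2.
case: k => k.
  elim: k => [|k IH]; first by rewrite base expr0z.
  by rewrite -addn1 PoszD haar_ballS IH -EFinM -{1}[N]expr1z -expfzDr ?gt_eqF// addrC.
rewrite NegzE; elim: k => [|k IH].
  have := haar_ballS (-1); rewrite addNr base => e.
  rewrite -[RHS]mule1 e muleA -EFinM exprN1 mulVf ?gt_eqF// mul1e//.
have := haar_ballS (- k.+2%:Z); rewrite -[in LHS]addn1 PoszD opprD subrK IH => e.
have -> : N ^ (- k.+2%:Z) = N^-1 * N ^ (- k.+1%:Z).
  by rewrite -exprN1 -expfzDr ?gt_eqF// -opprD -PoszD.
by rewrite EFinM e muleA -EFinM mulVf ?gt_eqF// mul1e.
Qed.

Lemma haar_sphere_le k : (mu (padic_sphere k) <= (N ^ k)%:E)%E.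
Proof.
rewrite -haar_ball le_measure ?inE//.
- exact: measurable_padic_sphere.
- exact: measurable_padic_ball.
- by move=> x xk; rewrite /padic_ball/= xk.
Qed.

Lemma haar_set0 : (0 < n)%N -> mu [set 0 : V] = 0%E.
Proof.
move=> n0; apply/eqP; rewrite eq_le measure_ge0 andbT; apply/lee_addgt0Pr => e e0.
have N1 : 1 < N by rewrite ltr1n -(exp1n n) ltn_exp2r// prime_gt1.
rewrite add0e.
have [k ke] : exists k, N ^- k < e.
  have [k _ /(_ k (leqnn k)) /= ke] := near_infty_natSinv_expn_lt (PosNum e0).
  exists k; apply: le_lt_trans ke; rewrite div1r lef_pV2 ?posrE ?exprn_gt0//; last exact: lt_trans N1.
  apply: lerXn2r; rewrite ?nnegrE ?ler0n// ler_nat.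
  by rewrite -(ltr_nat R).
apply: (@le_trans _ _ (mu (padic_ball (- k%:Z)))).
  apply: le_measure; rewrite ?inE.
  - exact: measurable_padic_zero.
  - exact: measurable_padic_ball.
  - by move=> x /= ->; rewrite /padic_ball/= padic_norm0 exprz_ge0.
by rewrite haar_ball -exprnN lee_fin ltW.
Qed.

End HaarMeasureOfBalls.

(** * Real powers *)

Section RealPowers.
Variable R : realType.
Implicit Types b x y r : R.

Lemma powRD_gt0 b x y : 0 < b -> b `^ (x + y) = b `^ x * b `^ y.
Proof. by move=> b0; rewrite powRD// (gt_eqF b0) implybT. Qed.

Lemma powR_gt1 b x : 1 < b -> 0 < x -> 1 < b `^ x.
Proof.
move=> b1 x0; have b0 : 0 < b by exact: lt_trans b1.
have := @gt0_ltr_powR R x x0 1 b; rewrite powR1 !nnegrE; apply=> //.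
exact: ltW.
Qed.

Lemma powR_lt1 b x : 1 < b -> x < 0 -> b `^ x < 1.
Proof.
move=> b1 x0; rewrite -[x]opprK powRN invf_lt1 ?powR_gt1 ?oppr_gt0//.
by rewrite powR_gt0// (lt_trans _ b1).
Qed.

Lemma powR_le_inv x y r : 0 < r -> 0 <= x -> 0 <= y -> x `^ r <= y `^ r -> x <= y.
Proof.
move=> r0 x0 y0; apply: contraTT; rewrite -!ltNge => yx.
exact: gt0_ltr_powR.
Qed.

End RealPowers.

(** * Sums over the integers *)

Section SumsOverIntegers.
Variable R : realType.
Local Open Scope ereal_scope.

(** The enumeration 0, -1, 1, -2, 2, ... *)
Definition int_enum (n : nat) : int := if odd n then Negz n./2 else Posz n./2.

Lemma int_enum_bij : set_bij [set: nat] [set: int] int_enum.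
Proof.
split=> //.
- move=> m n _ _ mn; rewrite -(odd_double_half m) -(odd_double_half n).
  by move: mn; rewrite /int_enum; case: (odd m); case: (odd n) => // -[->].
- move=> k _; case: k => k; [exists k.*2|exists k.*2.+1] => //;
    by rewrite /int_enum/= ?odd_double/= ?doubleK ?uphalf_double.
Qed.

Lemma esum_intE (a : int -> \bar R) : (forall k, 0 <= a k) ->
  \esum_(k in [set: int]) a k = \sum_(0 <= n <oo) a (int_enum n).
Proof.
move=> a0; rewrite nneseries_esumT//.
by rewrite (@reindex_esum R _ _ setT _ int_enum)//; exact: int_enum_bij.
Qed.

Lemma esum_intZ (c : R) (a : int -> \bar R) : (0 <= c)%R -> (forall k, 0 <= a k) ->
  \esum_(k in [set: int]) (c%:E * a k) = c%:E * \esum_(k in [set: int]) a k.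
Proof.
move=> c0 a0; rewrite !esum_intE// => [|k]; last by rewrite mule_ge0.
by rewrite nneseriesZl.
Qed.

Lemma esum_int_exchange (a : int -> int -> \bar R) : (forall i j, 0 <= a i j) ->
  \esum_(i in [set: int]) \esum_(j in [set: int]) a i j =
  \esum_(j in [set: int]) \esum_(i in [set: int]) a i j.
Proof.
move=> a0; rewrite !esum_intE//; [|by move=> k; exact: esum_ge0..].
under eq_eseriesr do rewrite esum_intE//.
under [RHS]eq_eseriesr do rewrite esum_intE//.
exact: nneseries_interchange.
Qed.

Lemma esum_int_subl m (a : int -> \bar R) : (forall k, 0 <= a k) ->
  \esum_(k in [set: int]) a (m - k)%R = \esum_(k in [set: int]) a k.
Proof.
move=> a0; rewrite [RHS](@reindex_esum R _ _ setT _ (fun k => m - k)%R)//.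
split=> // [x y _ _ /addrI/oppr_inj //|k _].
by exists (m - k)%R; rewrite ?subKr.
Qed.

Lemma nneseries_geometric_le (a x : R) : (0 <= a)%R -> (0 < x < 1)%R ->
  \sum_(0 <= n <oo) (a * x ^+ n)%:E <= (a / (1 - x))%:E.
Proof.
move=> a0 /andP[x0 x1]; apply: lime_le.
  by apply: is_cvg_nneseries => n _ _; rewrite lee_fin mulr_ge0// exprn_ge0// ltW.
apply: nearW => n; rewrite sumEFin lee_fin.
apply: (@geometric_le_lim R n a x) => //.
by rewrite gtr0_norm.
Qed.

(** Along [int_enum] the n-th integer has absolute value at least (n - 1)/2,
    so the sum is dominated by a geometric series of ratio b^(-d/2).  The bound
    is uniform in the centre m. *)
Lemma esum_int_geometric_le (b d : R) : (1 < b)%R -> (0 < d)%R ->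
  exists2 K : R, (0 <= K)%R & forall m : int,
    \esum_(k in [set: int]) (b `^ (- d * `|(m - k)%:~R|))%:E <= K%:E.
Proof.
move=> b1 d0; have b0 : (0 < b)%R by exact: lt_trans b1.
pose x := (b `^ (- (d / 2)))%R.
have x0 : (0 < x)%R by rewrite powR_gt0.
have x1 : (x < 1)%R by rewrite powR_lt1// oppr_lt0 divr_gt0.
exists (b `^ (d / 2) / (1 - x))%R => [|m].
  by rewrite divr_ge0 ?powR_ge0// subr_ge0 ltW.
rewrite (@esum_int_subl m (fun k => (b `^ (- d * `|k%:~R|))%:E)); last first.
  by move=> k; rewrite lee_fin powR_ge0.
rewrite esum_intE => [|k]; last by rewrite lee_fin powR_ge0.
apply: le_trans (nneseries_geometric_le (powR_ge0 _ _) _); last by rewrite x0.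
apply: lee_nneseries => n _; rewrite lee_fin ?powR_ge0//.
rewrite -powR_mulrn ?(ltW x0)// -powRrM -powRD_gt0//.
apply: ler_powR; first exact: ltW.
suff : (n%:R <= 2 * `|(int_enum n)%:~R| + 1 :> R)%R by nra.
rewrite -{1}(odd_double_half n) natrD -muln2 natrM /int_enum.
case: (odd n) => /=.
  by rewrite NegzE mulrNz normrN -pmulrn normr_nat -natr1; lra.
by rewrite -pmulrn normr_nat; lra.
Qed.

End SumsOverIntegers.

(** * Slowly varying majorants *)

Section Envelope.
Variable R : realType.
Local Open Scope ereal_scope.

Definition slowly_varying (b d : R) (e : int -> R) :=
  (forall k, 0 <= e k)%R /\
  (forall i j, e i <= b `^ (d * `|(i - j)%:~R|) * e j)%R.

(** The majorant is given by e_i^s = sum_k b^(-ds|i-k|) a_k^s.  The term k = i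
    gives a <= e, the triangle inequality gives slow variation, and summing over
    i first gives the comparison of the sums of s-th powers. *)
Lemma envelope (b d s : R) : (1 < b)%R -> (0 < d)%R -> (1 <= s)%R ->
  exists2 K : R, (0 <= K)%R & forall a : int -> R, (forall k, 0 <= a k)%R ->
    \esum_(k in [set: int]) (a k `^ s)%:E < +oo ->
    exists e : int -> R,
      [/\ slowly_varying b d e, forall k, (a k <= e k)%R &
          \esum_(k in [set: int]) (e k `^ s)%:E <=
            K%:E * \esum_(k in [set: int]) (a k `^ s)%:E].
Proof.
move=> b1 d0 s1; have s0 : (0 < s)%R by exact: lt_le_trans s1.
have b0 : (0 < b)%R by exact: lt_trans b1.
have ds0 : (0 < d * s)%R by rewrite mulr_gt0.
have [K K0 HK] := esum_int_geometric_le b1 ds0.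
exists K => // a a0 afin.
pose w i k := (b `^ (- (d * s) * `|(i - k)%:~R|) * a k `^ s)%R.
have w0 i k : 0 <= (w i k)%:E by rewrite lee_fin mulr_ge0 ?powR_ge0.
pose E i := \esum_(k in [set: int]) (w i k)%:E.
have E0 i : 0 <= E i by exact: esum_ge0.
have Efin i : E i \is a fin_num.
  rewrite ge0_fin_numE//; apply: le_lt_trans afin; apply: le_esum => k _.
  rewrite lee_fin ler_piMl ?powR_ge0// -[leRHS](powRr0 b) ler_powR ?(ltW b1)//.
  by rewrite mulNr oppr_le0 mulr_ge0// ltW.
have [e [e0 eE]] : exists e : int -> R,
    (forall i, 0 <= e i)%R /\ forall i, (e i `^ s)%:E = E i.
  exists (fun i => fine (E i) `^ s^-1)%R; split=> i; first exact: powR_ge0.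
  by rewrite -powRrM mulVf ?gt_eqF// powRr1 ?fine_ge0// fineK.
have ae k : (a k <= e k)%R.
  have : (a k `^ s <= e k `^ s)%R.
    rewrite -lee_fin eE; apply: le_trans (_ : (w k k)%:E <= _).
      by rewrite /w subrr normr0 mulr0 powRr0 mul1r.
    rewrite /E -(@esum_set1 R _ k (fun j => (w k j)%:E))//.
    rewrite [leRHS](esumID [set k])//. rewrite setTI.
    by rewrite leeDl// esum_ge0.
  by apply: powR_le_inv; rewrite ?powR_ge0.
exists e; split=> //.
- split=> // i j.
  have wij k : (w i k <= b `^ (d * s * `|(i - j)%:~R|) * w j k)%R.
    rewrite /w mulrA ler_wpM2r ?powR_ge0// -powRD_gt0//.
    apply: ler_powR; first exact: ltW.
    have := ler_normD ((j - i)%:~R : R) ((i - k)%:~R).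
    rewrite -intrD addrA subrK -(normrN (j - i)%:~R) -mulrNz opprB => h.
    by move: ds0 h; move: (d * s)%R => c; nra.
  have : (e i `^ s <= (b `^ (d * `|(i - j)%:~R|) * e j) `^ s)%R.
    rewrite powRM ?powR_ge0// -powRrM.
    have -> : (d * `|(i - j)%:~R| * s = d * s * `|(i - j)%:~R| :> R)%R by ring.
    rewrite -lee_fin EFinM (eE i) (eE j).
    rewrite -(esum_intZ (powR_ge0 _ _))//; apply: le_esum => k _.
    by rewrite -EFinM lee_fin.
  by apply: powR_le_inv; rewrite ?mulr_ge0 ?powR_ge0.
- under eq_esum do rewrite eE.
  rewrite /E esum_int_exchange// -esum_intZ//; last first.
    by move=> k; rewrite lee_fin powR_ge0.
  apply: le_esum => k _.
  under eq_esum do rewrite /w mulrC EFinM.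
  rewrite esum_intZ ?powR_ge0//; last by move=> i; rewrite lee_fin powR_ge0.
  rewrite muleC lee_wpmul2r ?lee_fin ?powR_ge0//.
  apply: le_trans (HK k); apply: le_esum => i _.
  by rewrite -opprB rmorphN/= normrN.
Qed.

End Envelope.

(** * Comparison of integrals of arbitrary functions *)

Import HBNNSimple.

Section IntegralsWithoutMeasurability.
Context {d} {T : measurableType d} {R : realType}.
Variable mu : {measure set T -> \bar R}.
Local Open Scope ereal_scope.

(** The integral of a nonnegative function is a supremum over simple functions
    below it.  A simple function below f on D, cut off outside the null set N,
    keeps its integral and lies below g on D'.  Only these simple functions are
    ever integrated in the argument, so it applies to f, whose superlevel sets
    need not be Borel. *)
Lemma ge0_le_integral_null (D D' N : set T) (f g : T -> \bar R) :
  measurable N -> mu N = 0 ->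
  (forall x, D x -> 0 <= f x) -> (forall x, D' x -> 0 <= g x) ->
  (forall x, ~ N x -> D x -> D' x /\ f x <= g x) ->
  \int[mu]_(x in D) f x <= \int[mu]_(x in D') g x.
Proof.
move=> mN N0 f0 g0 fg.
rewrite integral_mkcond [leRHS]integral_mkcond.
rewrite ge0_integralTE; last exact: erestrict_ge0.
apply: ge_ereal_sup => _ [h /= hf <-].
rewrite -integralT_nnsfun (@ge0_negligible_integral _ _ _ mu setT N)//; last 2 first.
- exact/measurable_EFinP/measurable_funP.
- by move=> x _; rewrite lee_fin.
rewrite integral_mkcond !ge0_integralTE; last 2 first.
- exact: erestrict_ge0.
- by apply: erestrict_ge0 => x _; rewrite lee_fin.
apply: le_ereal_sup => _ [k /= kh <-]; exists k => // x.
apply: (le_trans (kh x)); rewrite patchE; case: ifPn => [|_]; last exact: erestrict_ge0.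
rewrite inE => -[_ Nx]; apply: (le_trans (hf x)); rewrite !patchE.
case: ifPn => [/set_mem Dx|_]; last first.
  by case: ifPn => // /set_mem /g0.
by have [D'x ?] := fg _ Nx Dx; rewrite ifT// inE.
Qed.

Lemma ge0_le_integral_all (D : set T) (f g : T -> \bar R) :
  (forall x, D x -> 0 <= f x) -> (forall x, D x -> f x <= g x) ->
  \int[mu]_(x in D) f x <= \int[mu]_(x in D) g x.
Proof.
move=> f0 fg; apply: (@ge0_le_integral_null _ _ set0) => // x Dx.
  by apply: le_trans (fg _ _) => //; exact: f0.
by move=> Dx'; split=> //; exact: fg.
Qed.

(** The integrals of the positive and of the negative part both lie in [0, B],
    hence so does the absolute value of their difference. *)
Lemma Rintegral_bounded (f : T -> R) (B : R) :
  \int[mu]_x (`|f x|%R)%:E <= B%:E -> (`|Rintegral mu setT f| <= B)%R.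
Proof.
move=> fB; rewrite /Rintegral integralE.
have le_abs (h : T -> \bar R) : (forall x, 0 <= h x <= (`|f x|%R)%:E) ->
    exists2 v : R, (0 <= v <= B)%R & \int[mu]_x h x = v%:E.
  move=> hf; have h0 : 0 <= \int[mu]_x h x.
    by apply: integral_ge0 => x _; case/andP: (hf x).
  have hB : \int[mu]_x h x <= B%:E.
    apply: le_trans fB; apply: ge0_le_integral_all => x _; by case/andP: (hf x).
  have hfin : \int[mu]_x h x \is a fin_num.
    by rewrite ge0_fin_numE// (le_lt_trans hB)// ltry.
  exists (fine (\int[mu]_x h x)); last by rewrite fineK.
  by rewrite -!lee_fin fineK// h0.
have [x|u uB ->] := le_abs (fun x => (fun x => (f x)%:E)^\+ x).
  by rewrite funeposE le_max lexx orbT/= ge_max !lee_fin ler_norm normr_ge0.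
have [x|v vB ->] := le_abs (fun x => (fun x => (f x)%:E)^\- x).
  by rewrite funenegE le_max lexx orbT/= ge_max !lee_fin -[(`|f x|)%R]normrN ler_norm normr_ge0.
by rewrite /= ler_norml; move: uB vB; lra.
Qed.

End IntegralsWithoutMeasurability.

(** * Step functions on a partition indexed by the integers *)

Section PartitionsIndexedByIntegers.
Context {d} {T : measurableType d} {R : realType}.
Variable mu : {measure set T -> \bar R}.
Local Open Scope ereal_scope.
Variable F : int -> set T.
Hypothesis mF : forall k, measurable (F k).
Hypothesis tF : trivIset setT F.

Let bigcupF : \bigcup_k F k = \bigcup_n F (int_enum n).
Proof.
apply/seteqP; split=> x [k _ Fx].
  have [_ _ sur] := int_enum_bij; have [n _ nk] := sur k I.
  by exists n => //; rewrite nk.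
by exists (int_enum k).
Qed.

Let tFn : trivIset setT (F \o int_enum).
Proof.
move=> m n _ _ /(tF I I); have [_ inj _] := int_enum_bij.
by apply: inj; rewrite inE.
Qed.


Lemma ge0_integral_int_bigcup (f : T -> \bar R) :
  (forall k, measurable_fun (F k) f) ->
  (forall k x, F k x -> 0 <= f x) ->
  \int[mu]_(x in \bigcup_k F k) f x =
  \esum_(k in [set: int]) \int[mu]_(x in F k) f x.
Proof.
move=> mf f0; rewrite bigcupF ge0_integral_bigcup//; last 2 first.
- by apply/measurable_fun_bigcup => n; [exact: mF|exact: mf].
- by move=> x [n _ Fx]; exact: f0 Fx.
by rewrite esum_intE// => k; apply: integral_ge0 => x; exact: f0.
Qed.

Variable v : int -> R.
Hypothesis v0 : forall k, (0 <= v k)%R.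

(** The default index 0 is used only outside the union of the F k. *)
Let step (x : T) : \bar R := (v (xget 0 [set k | F k x]))%:E.

Let stepE k x : F k x -> step x = (v k)%:E.
Proof.
move=> Fkx; rewrite /step; case: xgetP => [l _ /= Flx|/(_ k) //].
by congr (v _)%:E; apply: (tF I I); exists x.
Qed.

Let integral_step : \int[mu]_(x in \bigcup_k F k) step x =
  \esum_(k in [set: int]) ((v k)%:E * mu (F k)).
Proof.
rewrite ge0_integral_int_bigcup; last 2 first.
- move=> k; apply: (eq_measurable_fun (cst (v k)%:E)).
    by move=> x /set_mem /stepE.
  exact: measurable_cst.
- by move=> k x /stepE ->; rewrite lee_fin.
apply: eq_esum => k _; rewrite -integral_cst//.
by apply: eq_integral => x /set_mem /stepE ->.
Qed.

Lemma integral_le_step (f : T -> \bar R) :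
  (forall k x, F k x -> 0 <= f x <= (v k)%:E) ->
  \int[mu]_(x in \bigcup_k F k) f x <=
  \esum_(k in [set: int]) ((v k)%:E * mu (F k)).
Proof.
move=> fv; rewrite -integral_step.
apply: ge0_le_integral_all => x [k _ Fx]; first by case/andP: (fv _ _ Fx).
by rewrite (stepE Fx); case/andP: (fv _ _ Fx).
Qed.

Lemma step_le_integral (f : T -> \bar R) :
  (forall k x, F k x -> (v k)%:E <= f x) ->
  \esum_(k in [set: int]) ((v k)%:E * mu (F k)) <=
  \int[mu]_(x in \bigcup_k F k) f x.
Proof.
move=> fv; rewrite -integral_step.
apply: ge0_le_integral_all => x [k _ Fx]; first by rewrite lee_fin.
by rewrite (stepE Fx); exact: fv.
Qed.

End PartitionsIndexedByIntegers.

(** * The Lorentz integral as a sum over the integers *)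

Section GeometricPartition.
Variable R : realType.
Variables (x c : R).
Hypotheses (x1 : 1 < x) (c0 : 0 < c).

Let x0 : 0 < x. Proof. exact: lt_trans x1. Qed.

Definition geo_itv (k : int) : set R :=
  `[c * x `^ k%:~R, c * x `^ (k + 1)%:~R[%classic.

Lemma geo_itvS k : x `^ (k + 1)%:~R = x * x `^ k%:~R.
Proof. by rewrite intrD powRD_gt0// powRr1 ?ltW// mulrC. Qed.

Lemma measurable_geo_itv k : measurable (geo_itv k).
Proof. exact: measurable_itv. Qed.

Lemma geo_itv_gt0 k t : geo_itv k t -> 0 < t.
Proof.
rewrite /geo_itv/= in_itv/= => /andP[+ _]; apply: lt_le_trans.
by rewrite mulr_gt0 ?powR_gt0.
Qed.

Lemma geo_itv_trivIset : trivIset setT geo_itv.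
Proof.
suff lek k l t : geo_itv k t -> geo_itv l t -> k <= l.
  by move=> k l _ _ [t [kt lt]]; apply/le_anti/andP; split; apply: (lek _ _ t).
rewrite /geo_itv/= !in_itv/= => /andP[kt _] /andP[_ tl].
rewrite -ltzD1 ltNge; apply/negP => lk.
suff : c * x `^ (l + 1)%:~R <= c * x `^ k%:~R by move=> /(lt_le_trans tl) /lt_le_trans /(_ kt); rewrite ltxx.
by rewrite ler_pM2l// ler_powR ?(ltW x1)// ler_int.
Qed.

Lemma geo_itv_bigcup : \bigcup_k geo_itv k = `]0, +oo[%classic.
Proof.
apply/seteqP; split=> t /=.
  by move=> [k _ /geo_itv_gt0 t0]; rewrite in_itv/= t0.
rewrite in_itv/= andbT => t0.
have lx : 0 < ln x by rewrite ln_gt0.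
have tc : 0 < t / c by rewrite divr_gt0.
pose y := ln (t / c) / ln x.
have tE : t = c * x `^ y.
  by rewrite /powR gt_eqF// /y divfK ?gt_eqF// lnK ?posrE// mulrCA divff ?mulr1 ?gt_eqF.
exists (Num.floor y) => //; rewrite /geo_itv/= in_itv/= tE.
have /andP[fy yf] := floor_itv y.
rewrite ler_pM2l// ltr_pM2l// ler_powR ?(ltW x1)//=.
rewrite -[(Num.floor y + 1)%:~R](subrK y) powRD_gt0// -[ltLHS]mul1r.
by rewrite ltr_pM2r ?powR_gt0// powR_gt1// subr_gt0.
Qed.

Lemma lebesgue_geo_itv k :
  lebesgue_measure (geo_itv k) = (c * x `^ k%:~R * (x - 1))%:E.
Proof.
rewrite /geo_itv lebesgue_measure_itv/= lte_fin geo_itvS.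
rewrite ltr_pM2l// -[ltLHS]mul1r ltr_pM2r ?powR_gt0// x1.
by rewrite -EFinB; congr (_%:E); ring.
Qed.

End GeometricPartition.

Section LorentzIntegral.
Variable R : realType.
Variables (x q s : R).
Hypotheses (x1 : 1 < x) (q0 : 0 < q) (s0 : 0 < s).
Implicit Types (phi : R -> \bar R).

Let x0 : 0 < x. Proof. exact: lt_trans x1. Qed.

(** The integral inside [lorentz_norm], for any function in the place of the
    rearrangement. *)
Definition lorentz_integral phi : \bar R :=
  (\int[lebesgue_measure]_(t in `]0%R, +oo[)
     (((t `^ q^-1)%:E * phi t) `^ s * (t^-1)%:E))%E.

Lemma lorentz_integrand_ge0 phi t : 0 < t ->
  (0 <= ((t `^ q^-1)%:E * phi t) `^ s * (t^-1)%:E)%E.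
Proof. by move=> t0; rewrite mule_ge0 ?poweR_ge0// lee_fin invr_ge0 ltW. Qed.

Lemma lorentz_integral_ge0 phi : (0 <= lorentz_integral phi)%E.
Proof.
apply: integral_ge0 => t /=; rewrite in_itv/= andbT; exact: lorentz_integrand_ge0.
Qed.

(** On the k-th interval the factor t^(1/q) is at most its value at the right
    end and 1/t at most its value at the left end, while the length is
    c x^k (x - 1). *)
Lemma lorentz_integral_le c phi (u : int -> R) : 0 < c ->
  (forall k, 0 <= u k) -> (forall t, (0 <= phi t)%E) ->
  (forall k t, geo_itv x c k t -> (phi t <= (u k)%:E)%E) ->
  (lorentz_integral phi <= (c `^ (s / q) * x `^ (s / q) * (x - 1))%:E *
     \esum_(k in [set: int]) ((x `^ (k%:~R / q) * u k) `^ s)%:E)%E.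
Proof.
move=> c0 u0 phi0 phiu.
pose v k := ((c * x `^ (k + 1)%:~R) `^ q^-1 * u k) `^ s * (c * x `^ k%:~R)^-1.
have v0 k : 0 <= v k by rewrite mulr_ge0 ?powR_ge0// invr_ge0 mulr_ge0 ?powR_ge0 ?ltW.
rewrite /lorentz_integral -(geo_itv_bigcup x1 c0).
have step k t : geo_itv x c k t ->
  (0 <= ((t `^ q^-1)%:E * phi t) `^ s * (t^-1)%:E <= (v k)%:E)%E.
  move=> kt; have t0 := geo_itv_gt0 x1 c0 kt.
  rewrite lorentz_integrand_ge0//= /v EFinM.
  have tk := kt; move: tk; rewrite /geo_itv/= in_itv/= => /andP[kt1 kt2].
  apply: lee_pmul; rewrite ?poweR_ge0 ?lee_fin ?invr_ge0 ?(ltW t0)//; last first.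
    by rewrite lef_pV2 ?posrE ?mulr_gt0 ?powR_gt0.
  rewrite -[leRHS]poweR_EFin; apply: (gt0_ler_poweR (ltW s0)).
  - by rewrite in_itv/= leey andbT mule_ge0 ?lee_fin ?powR_ge0.
  - by rewrite in_itv/= leey andbT lee_fin mulr_ge0 ?powR_ge0.
  - rewrite EFinM; apply: lee_pmul; rewrite ?lee_fin ?powR_ge0 ?phiu//.
    by rewrite ge0_ler_powR ?invr_ge0 ?nnegrE ?(ltW q0) ?(ltW t0) ?mulr_ge0 ?powR_ge0 ?(ltW c0) ?(ltW kt2).
apply: (le_trans (integral_le_step lebesgue_measure
  (measurable_geo_itv x c) (geo_itv_trivIset x1 c0) v0 step)).
rewrite -esum_intZ; last 2 first.
- by rewrite !mulr_ge0 ?powR_ge0// subr_ge0 ltW.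
- by move=> k; rewrite lee_fin powR_ge0.
apply: le_esum => k _.
rewrite [X in (_ * X <= _)%E](lebesgue_geo_itv x1 c0 k) -!EFinM lee_fin le_eqVlt; apply/orP; left; apply/eqP.
have ckx : c * x `^ k%:~R != 0 by rewrite mulf_neq0// gt_eqF// powR_gt0.
rewrite /v (geo_itvS x1).
rewrite !powRM ?powR_ge0 ?mulr_ge0 ?powR_ge0 ?(ltW c0) ?(ltW x0)//.
rewrite -!powRrM !(mulrC q^-1 s) mulrACA.
have -> : k%:~R / q * s = k%:~R * (s / q) by rewrite -mulrA [q^-1 * s]mulrC.
by move: ckx; rewrite mulf_eq0 negb_or => /andP[cn xk]; field; rewrite cn xk.
Qed.

(** On [x^k, x^(k+1)[ the function phi is at least its value at the right end,
    which accounts for the shift of the index by one; an infinite value there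
    would make the integral infinite. *)
Lemma lorentz_integral_ge phi :
  (forall t, (0 <= phi t)%E) ->
  (forall t t', 0 < t -> t <= t' -> (phi t' <= phi t)%E) ->
  (lorentz_integral phi < +oo)%E ->
  (forall k : int, phi (x `^ k%:~R) \is a fin_num) /\
  (\esum_(k in [set: int]) ((x `^ (k%:~R / q) * fine (phi (x `^ k%:~R)%R)) `^ s)%:E
    <= (x `^ (s / q) / (1 - x^-1))%:E * lorentz_integral phi)%E.
Proof.
move=> phi0 phin fin.
have phik (k : int) t : geo_itv x 1 k t -> (phi (x `^ (k + 1)%:~R)%R <= phi t)%E.
  move=> kt; apply: phin; first exact: geo_itv_gt0 kt.
  by move: kt; rewrite /geo_itv/= in_itv/= !mul1r => /andP[_ /ltW].
have phifin (k : int) : phi (x `^ (k + 1)%:~R) \is a fin_num.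
  rewrite ge0_fin_numE// ltey; apply/eqP => phiy; move: fin; rewrite ltNge => /negP; apply.
  apply: (@le_trans _ _ (\int[lebesgue_measure]_(t in geo_itv x 1 k) (cst +oo t))%E).
    rewrite integral_cst; last exact: measurable_geo_itv.
    rewrite [X in (_ <= _ * X)%E](lebesgue_geo_itv x1 ltr01 k) gt0_mulye// lte_fin mul1r mulr_gt0 ?powR_gt0//.
    by rewrite subr_gt0.
  apply: (@ge0_le_integral_null _ _ _ _ _ _ set0) => //.
  - by move=> t _; rewrite leey.
  - by move=> t /=; rewrite in_itv/= andbT; exact: lorentz_integrand_ge0.
  - move=> t _ kt; have t0 := geo_itv_gt0 x1 ltr01 kt; split; first by rewrite /= in_itv/= t0.
    have := phik _ _ kt; rewrite phiy leye_eq => /eqP ->.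
    rewrite gt0_muley ?lte_fin ?powR_gt0// poweRyr ?gt_eqF// gt0_mulye//.
    by rewrite lte_fin invr_gt0.
have phifin' (k : int) : phi (x `^ k%:~R) \is a fin_num.
  by have := phifin (k - 1); rewrite subrK.
split=> //.
pose v k := (x `^ (k%:~R / q) * fine (phi (x `^ (k + 1)%:~R))) `^ s / x `^ (k + 1)%:~R.
have v0 k : 0 <= v k by rewrite mulr_ge0 ?powR_ge0// invr_ge0 powR_ge0.
have step k t : geo_itv x 1 k t ->
  ((v k)%:E <= ((t `^ q^-1)%:E * phi t) `^ s * (t^-1)%:E)%E.
  move=> kt; have t0 := geo_itv_gt0 x1 ltr01 kt.
  have tk := kt; move: tk; rewrite /geo_itv/= in_itv/= !mul1r => /andP[kt1 kt2].
  rewrite /v EFinM; apply: lee_pmul; rewrite ?lee_fin ?invr_ge0 ?powR_ge0//; last first.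
    by rewrite lef_pV2 ?posrE ?powR_gt0 ?(ltW kt2).
  rewrite -[leLHS]poweR_EFin; apply: (gt0_ler_poweR (ltW s0)).
  - by rewrite in_itv/= leey andbT lee_fin mulr_ge0 ?powR_ge0// fine_ge0.
  - by rewrite in_itv/= leey andbT mule_ge0 ?lee_fin ?powR_ge0.
  - rewrite EFinM; apply: lee_pmul; rewrite ?lee_fin ?powR_ge0 ?fine_ge0//.
      by rewrite powRrM ge0_ler_powR ?invr_ge0 ?nnegrE ?(ltW q0) ?(ltW t0) ?powR_ge0.
    by rewrite fineK// phik.
have := step_le_integral lebesgue_measure
  (measurable_geo_itv x 1) (geo_itv_trivIset x1 ltr01) v0 step.
rewrite (geo_itv_bigcup x1 ltr01) -/(lorentz_integral phi) => le_int.
have xx : 0 < 1 - x^-1 by rewrite subr_gt0 invf_lt1.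
rewrite (@reindex_esum R _ _ setT _ (fun k => k + 1)); last first.
  split=> //= [k l _ _ /addIr //|k _]; by exists (k - 1) => //; rewrite subrK.
apply: le_trans (lee_wpmul2l _ le_int); last by rewrite lee_fin divr_ge0 ?powR_ge0 ?ltW.
rewrite -esum_intZ ?divr_ge0 ?powR_ge0 ?(ltW xx)//; last first.
  by move=> k; rewrite mule_ge0// lee_fin.
apply: le_esum => k _.
rewrite [X in (_ <= _ * (_ * X))%E](lebesgue_geo_itv x1 ltr01 k) -!EFinM lee_fin le_eqVlt; apply/orP; left; apply/eqP.
rewrite /v; have := fine_ge0 (phi0 (x `^ (k + 1)%:~R)).
move: (fine _) => w w0.
have -> : (k + 1)%:~R / q = k%:~R / q + q^-1 by rewrite intrD mulrDl mul1r.
rewrite powRD_gt0// !(powRM s) ?mulr_ge0 ?powR_ge0//.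
rewrite -!powRrM [q^-1 * s]mulrC geo_itvS//.
have xk : x `^ k%:~R != 0 by rewrite gt_eqF// powR_gt0.
have xn : x != 0 by rewrite gt_eqF.
have x1n : x - 1 != 0 by rewrite subr_eq0 gt_eqF.
by field; rewrite xk xn x1n.
Qed.

End LorentzIntegral.

(** * Modulus of complex numbers *)

Section ComplexModulus.
Variable R : realType.
Implicit Types z : R[i].

Lemma normc_ge0 z : 0 <= Normc.normc z.
Proof. by case: z => a b; exact: sqrtr_ge0. Qed.

Lemma normr_Re_le z : `|complex.Re z| <= Normc.normc z.
Proof.
by case: z => a b /=; rewrite -sqrtr_sqr ler_wsqrtr// lerDl sqr_ge0.
Qed.

Lemma normr_Im_le z : `|complex.Im z| <= Normc.normc z.
Proof.
by case: z => a b /=; rewrite -sqrtr_sqr ler_wsqrtr// lerDr sqr_ge0.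
Qed.

Lemma normc_le_ReIm z : Normc.normc z <= `|complex.Re z| + `|complex.Im z|.
Proof.
case: z => a b /=; rewrite -[leRHS]ger0_norm ?addr_ge0// -sqrtr_sqr ler_wsqrtr//.
rewrite sqrrD !real_normK ?num_real// lerD2r lerDl.
by rewrite mulrn_wge0// mulr_ge0.
Qed.

Lemma normc_real (a : R) : 0 <= a -> Normc.normc (real_complex R a) = a.
Proof. by move=> a0; rewrite /= expr0n/= addr0 sqrtr_sqr ger0_norm. Qed.

End ComplexModulus.

(** * Geometric decay of the profile psi *)

Section ProfileDecay.
Variable R : realType.

(** The contribution of the single interval [x^k, x^(k+1)[ to the integral is
    comparable with (h(x^k) x^(ck))^u. *)
Lemma step_function_bounded (x c u : R) (h : R -> R) : 1 < x -> 0 < u ->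
  (forall t, 0 <= h t) ->
  (forall (k : int) t, x `^ k%:~R <= t < x `^ (k + 1)%:~R -> h t = h (x `^ k%:~R)) ->
  (\int[lebesgue_measure]_(t in `]0%R, +oo[)
     (h t `^ u * t `^ (c * u - 1))%:E < +oo)%E ->
  exists2 C : R, 0 <= C & forall k : int, h (x `^ k%:~R) * x `^ (c * k%:~R) <= C.
Proof.
move=> x1 u0 h0 hstep; have x0 : 0 < x by exact: lt_trans x1.
set J := (\int[_]_(_ in _) _)%E => Jfin.
(* x^(ke) m is the smaller of the values of t^e at the two ends of the interval *)
pose e := c * u - 1; pose m := Num.min 1 (x `^ e).
have m0 : 0 < m by rewrite lt_min ltr01 powR_gt0.
have J0 : (0 <= J)%E by apply: integral_ge0 => t _; rewrite lee_fin mulr_ge0 ?powR_ge0.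
have JE : J = (fine J)%:E by rewrite fineK// ge0_fin_numE.
have xm0 : 0 < m * (x - 1) by rewrite mulr_gt0// subr_gt0.
exists ((fine J / (m * (x - 1))) `^ u^-1) => [|k]; first exact: powR_ge0.
apply: (powR_le_inv u0); rewrite ?mulr_ge0 ?powR_ge0//.
rewrite -[leRHS]powRrM mulVf ?gt_eqF// powRr1 ?divr_ge0 ?fine_ge0 ?(ltW xm0)//.
rewrite ler_pdivlMr// -lee_fin -JE.
pose v := h (x `^ k%:~R) `^ u * (x `^ (e * k%:~R) * m).
have vJ : (v%:E * (x `^ k%:~R * (x - 1))%:E <= J)%E.
  have := lebesgue_geo_itv x1 ltr01 k; rewrite mul1r => <-.
  rewrite -integral_cst; last exact: measurable_geo_itv.
  apply: (@ge0_le_integral_null _ _ _ _ _ _ set0) => //.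
  - by move=> t _; rewrite lee_fin !mulr_ge0 ?powR_ge0// ltW.
  - by move=> t _; rewrite lee_fin mulr_ge0 ?powR_ge0.
  - move=> t _ kt; have t0 := geo_itv_gt0 x1 ltr01 kt.
    split; first by rewrite /= in_itv/= t0.
    move: kt; rewrite /geo_itv/= in_itv/= !mul1r => kt.
    rewrite lee_fin (hstep _ _ kt) ler_wpM2l ?powR_ge0// -/e.
    move: kt => /andP[kt tk].
    have [e0|e0] := leP 0 e.
      rewrite (mulrC e) powRrM; apply: (@le_trans _ _ ((x `^ k%:~R) `^ e * 1)).
        by rewrite ler_wpM2l ?powR_ge0// ge_min lexx.
      by rewrite mulr1 ge0_ler_powR ?nnegrE ?powR_ge0 ?(ltW t0).
    apply: (@le_trans _ _ (x `^ (e * k%:~R) * x `^ e)).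
      by rewrite ler_wpM2l ?powR_ge0// ge_min lexx orbT.
    have powN y : y `^ e = (y `^ (- e))^-1 by rewrite powRN invrK.
    rewrite -powRD_gt0// -{2}[e]mulr1 -mulrDr (mulrC e) powRrM !powN.
    rewrite -[1]/(1%:~R) -intrD lef_pV2 ?posrE ?powR_gt0//.
    by rewrite ge0_ler_powR ?nnegrE ?powR_ge0 ?(ltW t0) ?oppr_ge0 ?(ltW e0) ?(ltW tk).
apply: le_trans vJ; rewrite -EFinM lee_fin /v powRM ?powR_ge0// -powRrM.
have -> : c * k%:~R * u = e * k%:~R + k%:~R by rewrite /e; ring.
rewrite powRD_gt0// le_eqVlt; apply/orP; left; apply/eqP; ring.
Qed.

(** With u' - 1 = u'/u the weight in the hypothesis is t^((A/u - b)u' - 1), so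
    [step_function_bounded] bounds |psi(x^k)| x^((A/u - b)k) for both values of
    u.  As A/(q + eps) < A/q < A/(q - eps), the first bound gives decay for
    k >= 0 and the second one for k < 0. *)
Lemma profile_decay (x A b q eps : R) (psi : R -> R[i]) :
  1 < x -> 0 < A -> 0 < eps -> 1 < q - eps ->
  (forall (k : int) (t : R), x ^ k <= t < x ^ (k + 1) -> psi t = psi (x ^ k)) ->
  (forall u u' : R, u = q - eps \/ u = q + eps -> u^-1 + u'^-1 = 1 ->
     (\int[lebesgue_measure]_(t in `]0%R, +oo[)
        (Normc.normc (psi t) `^ u'
           * t `^ (A * (u' - 1) - b * u' - 1))%:E < +oo)%E) ->
  exists C d : R, [/\ 0 <= C, 0 < d & forall k : int,
    Normc.normc (psi (x `^ k%:~R)) * x `^ ((A / q - b) * k%:~R) <=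
    C * x `^ (- d * `|k%:~R|)].
Proof.
move=> x1 A0 eps0 q1 psistep psiint.
have x0 : 0 < x by exact: lt_trans x1.
have q0 : 0 < q by lra.
have normc0 := @normc_ge0 R.
have key u : u = q - eps \/ u = q + eps -> exists2 C : R, 0 <= C & forall k : int,
    Normc.normc (psi (x `^ k%:~R)) * x `^ ((A / u - b) * k%:~R) <= C.
  move=> hu; have u1 : 1 < u by case: hu => ->; lra.
  have u0 : 0 < u by exact: lt_trans u1.
  have v0 : 0 < 1 - u^-1 by rewrite subr_gt0 invf_lt1.
  pose u' := (1 - u^-1)^-1.
  have u'0 : 0 < u' by rewrite invr_gt0.
  apply: (step_function_bounded (h := fun t => Normc.normc (psi t)) (u := u')) => //.
    by move=> k t; rewrite !powR_intmul ?(ltW x0)// => /psistep ->.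
  have := psiint u u' hu; rewrite invrK addrC subrK => /(_ erefl).
  suff -> : A * (u' - 1) - b * u' - 1 = (A / u - b) * u' - 1 by [].
  have : u' - 1 = u' / u.
    rewrite /u'; field; rewrite gt_eqF//=.
    by rewrite subr_eq0 gt_eqF.
  by move=> ->; ring.
have [C1 C10 H1] := key (q - eps) (or_introl erefl).
have [C2 C20 H2] := key (q + eps) (or_intror erefl).
pose d1 := A / (q - eps) - A / q; pose d2 := A / q - A / (q + eps).
have d10 : 0 < d1.
  by rewrite subr_gt0 ltr_pM2l// ltf_pV2 ?posrE//; lra.
have d20 : 0 < d2.
  by rewrite subr_gt0 ltr_pM2l// ltf_pV2 ?posrE//; lra.
exists (C1 + C2), (Num.min d1 d2); split; [exact: addr_ge0|by rewrite lt_min d10|].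
move=> k; set H := Normc.normc _.
have bound C d : 0 <= C -> 0 < Num.min d1 d2 ->
    H * x `^ ((A / q - b) * k%:~R) * x `^ (d * k%:~R) <= C ->
    Num.min d1 d2 * `|k%:~R| <= d * k%:~R ->
    H * x `^ ((A / q - b) * k%:~R) <= C * x `^ (- Num.min d1 d2 * `|k%:~R|).
  move=> C0 dm0 hC hd; rewrite mulNr powRN ler_pdivlMr ?powR_gt0//.
  apply: le_trans hC; rewrite ler_wpM2l ?mulr_ge0 ?powR_ge0 ?normc0//.
  by rewrite ler_powR ?(ltW x1).
have dm0 : 0 < Num.min d1 d2 by rewrite lt_min d10.
have [k0|k0] := leP 0 (k%:~R : R).
  apply: le_trans (ler_wpM2r (powR_ge0 _ _) (_ : C1 <= _)); last by rewrite lerDl.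
  apply: (bound C1 d1) => //.
    rewrite -mulrA -powRD_gt0// -mulrDl.
    have -> : A / q - b + d1 = A / (q - eps) - b by rewrite /d1; ring.
    exact: H1.
  by rewrite ger0_norm// ler_wpM2r// ge_min lexx.
apply: le_trans (ler_wpM2r (powR_ge0 _ _) (_ : C2 <= _)); last by rewrite lerDr.
apply: (bound C2 (- d2)) => //.
  rewrite -mulrA -powRD_gt0// -mulrDl.
  have -> : A / q - b - d2 = A / (q + eps) - b by rewrite /d2; ring.
  exact: H2.
by rewrite ltr0_norm// mulrN mulNr lerN2 ler_wnM2r ?(ltW k0)// ge_min lexx orbT.
Qed.

End ProfileDecay.

(** * Radial functions and power weights *)

Section RadialFunctions.
Variables (R : realType) (p : nat) (p_pr : prime p) (n : nat).
Local Notation V := (padic_space p_pr n).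
Local Notation P := (p%:R : R).

Lemma padic_base_gt1 : 1 < P. Proof. by rewrite ltr1n prime_gt1. Qed.
Lemma padic_base_gt0 : 0 < P. Proof. by rewrite ltr0n prime_gt0. Qed.
Hint Resolve padic_base_gt0 padic_base_gt1 : core.

Lemma measurable_fun_norm d (U : measurableType d) (F : rat -> U) (D : set V) :
  measurable_fun D (fun x => F (padic_norm x)).
Proof.
move=> mD B mB; apply: measurableI => //.
exact: (measurable_norm_set [set t | B (F t)]).
Qed.

Lemma padic_normR_sphere k (x : V) : padic_sphere k x ->
  padic_normR R x = P `^ k%:~R.
Proof.
rewrite /padic_normR => ->; rewrite rmorphXz/= ?ratr_nat ?powR_intmul ?ler0n//.
by rewrite unitfE pnatr_eq0 -lt0n prime_gt0.
Qed.

Lemma power_weight_sphere a k (x : V) : padic_sphere k x ->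
  power_weight a x = P `^ (a * k%:~R).
Proof. by move=> /padic_normR_sphere; rewrite /power_weight => ->; rewrite mulrC powRrM. Qed.

Lemma power_weight_ge0 a (x : V) : 0 <= (power_weight a x : R).
Proof. exact: powR_ge0. Qed.

Lemma measurable_power_weight a (D : set V) :
  measurable_fun D (fun x => ((power_weight a x : R)%:E)).
Proof.
exact: (@measurable_fun_norm _ _ (fun t => (((ratr t : R) `^ a)%:E))).
Qed.

Lemma padic_sphere_trivIset : trivIset setT (@padic_sphere p p_pr n).
Proof.
move=> k l _ _ [x [xk xl]]; have := etrans (esym xk) xl.
by apply: ieexprIz; rewrite ?ltr0n ?prime_gt0// gt_eqF// ltr1n prime_gt1.
Qed.

Lemma padic_sphere_ex (x : V) : x != 0 -> exists k, padic_sphere k x.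
Proof. exact: padic_norm_val. Qed.

End RadialFunctions.

#[local] Hint Resolve padic_base_gt0 padic_base_gt1 : core.

(** * Weighted estimates on balls and spheres *)

Section WeightedEstimates.
Variables (R : realType) (p : nat) (p_pr : prime p) (n : nat).
Local Notation V := (padic_space p_pr n).
Local Notation P := (p%:R : R).
Variable mu : {measure set V -> \bar R}.
Hypotheses (n0 : (0 < n)%N) (haar : is_haar mu).
Local Notation S := (@padic_sphere p p_pr n).
Local Notation ball := (@padic_ball p p_pr n).

Let P1 : 1 < P. Proof. exact: padic_base_gt1. Qed.
Let P0 : 0 < P. Proof. exact: padic_base_gt0. Qed.

Lemma haar_sphere_powR k : (mu (S k) <= (P `^ (n%:R * k%:~R))%:E)%E.
Proof.
apply: le_trans (haar_sphere_le haar k) _; rewrite lee_fin powRrM powR_mulrn ?(ltW P0)//.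
by rewrite powR_intmul ?natrX// exprn_ge0 ?ltW.
Qed.


(** Sum over the spheres of radius p^(m-d), d >= 0: the integral over each is
    at most p^((n+a)(m-d)), and the origin is a null set. *)
Lemma integral_power_weight_ball a m : 0 < n%:R + a ->
  (\int[mu]_(x in ball m) (power_weight a x)%:E <=
   ((1 - P `^ (- (n%:R + a)))^-1 * P `^ ((n%:R + a) * m%:~R))%:E)%E.
Proof.
move=> na0; pose F (d : nat) := S (m - d%:Z).
have tF : trivIset setT F.
  by move=> c d _ _ /(padic_sphere_trivIset I I) /addrI /oppr_inj [].
have mF d : measurable (F d) by exact: measurable_padic_sphere.
apply: (@le_trans _ _ (\int[mu]_(x in \bigcup_d F d) (power_weight a x)%:E)%E).
  apply: (@ge0_le_integral_null _ _ _ _ _ _ ([set 0] : set V)).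
  - exact: measurable_padic_zero.
  - exact: haar_set0.
  - by move=> x _; rewrite lee_fin power_weight_ge0.
  - by move=> x _; rewrite lee_fin power_weight_ge0.
  - move=> x /eqP/padic_sphere_ex[k xk] xm; split=> //.
    have km : k <= m.
      move: xm; rewrite /padic_ball/= xk ler_eXz2l//.
      by rewrite ltr1n prime_gt1.
    by exists `|m - k|%N => //; rewrite /F gez0_abs ?subr_ge0// subKr.
rewrite ge0_integral_bigcup//; last 2 first.
- exact: measurable_power_weight.
- by move=> x _; rewrite lee_fin power_weight_ge0.
set A := n%:R + a; rewrite -/A in na0.
apply: (@le_trans _ _ (\sum_(0 <= d <oo)
    (P `^ (A * m%:~R) * (P `^ (- A)) ^+ d)%:E)%E); last first.
  rewrite [X in (X%:E)%E]mulrC; apply: nneseries_geometric_le; first exact: powR_ge0.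
  by rewrite powR_gt0// powR_lt1// oppr_lt0.
apply: lee_nneseries => d _.
  by move=> _; apply: integral_ge0 => x _; rewrite lee_fin power_weight_ge0.
rewrite (@eq_integral _ _ _ _ _ (cst (P `^ (a * (m - d%:Z)%:~R))%:E)); last first.
  by move=> x /set_mem/power_weight_sphere ->.
rewrite integral_cst//; apply: le_trans (lee_wpmul2l _ (haar_sphere_powR _)) _.
  by rewrite lee_fin powR_ge0.
rewrite -EFinM lee_fin -powRD_gt0// -powR_mulrn ?powR_ge0// -powRrM -powRD_gt0//.
rewrite ler_powR ?(ltW P1)// le_eqVlt; apply/orP; left; apply/eqP.
by rewrite /A intrB -pmulrn; ring.
Qed.

(** At a point of S_j consider the least d with h <= L (j-d).  If d = 0, then
    h <= L j.  If d = i+1, then h <= p^(l(i+1)) L j, and the point lies in the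
    set L (j-i) < h, whose part in S_j has measure at most
    p^(-aj) p^((n+a)(j-i)).  The series over i converges because l < n + a.  The
    points of S_j without such a d form a null set. *)
Lemma integral_sphere_le (a l : R) (h : V -> R) (L : int -> R) (j : int) :
  0 < n%:R + a -> l < n%:R + a ->
  measurable_fun setT h -> (forall x, 0 <= h x) -> (forall i, 0 <= L i) ->
  (forall i, (\int[mu]_(x in [set x | (L i < h x)%R]) (power_weight a x)%:E <=
    (P `^ ((n%:R + a) * i%:~R))%:E)%E) ->
  (forall d : nat, L (j - d%:Z) <= P `^ (l * d%:R) * L j) ->
  (\int[mu]_(x in S j) (h x)%:E <=
    ((1 + P `^ l / (1 - P `^ (l - (n%:R + a)))) * P `^ (n%:R * j%:~R) * L j)%:E)%E.
Proof.
set A := n%:R + a => A0 lA mh h0 L0 hL Lj.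
pose E i := [set x | L i < h x].
have mE i : measurable (E i).
  rewrite (_ : E i = setT `&` h @^-1` `]L i, +oo[%classic).
    by apply: mh => //; exact: measurable_itv.
  by apply/seteqP; split=> x /=; rewrite in_itv/= andbT => // -[].
have mS : measurable (S j) by exact: measurable_padic_sphere.
have muE i : (mu (E i `&` S j) <= (P `^ (- a * j%:~R) * P `^ (A * i%:~R))%:E)%E.
  have -> : mu (E i `&` S j) = ((P `^ (- a * j%:~R))%:E *
      \int[mu]_(x in E i `&` S j) (power_weight a x)%:E)%E.
    rewrite (@eq_integral _ _ _ _ _ (cst (P `^ (a * j%:~R))%:E)); last first.
      by move=> x /set_mem[_ /power_weight_sphere ->].
    rewrite integral_cst; last exact: measurableI.
    by rewrite muleA -EFinM -powRD_gt0// mulNr addNr powRr0 mul1e.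
  rewrite EFinM lee_wpmul2l ?lee_fin ?powR_ge0//; apply: le_trans (hL i).
  apply: ge0_subset_integral => //; first exact: measurableI.
  - exact: (mE i).
  - exact: measurable_power_weight.
  - by move=> x _; rewrite lee_fin power_weight_ge0.
pose N := S j `&` \bigcap_d E (j - d%:Z).
have mN : measurable N by apply: measurableI => //; apply: bigcapT_measurable.
have N0 : mu N = 0%E.
  apply/eqP; rewrite eq_le measure_ge0 andbT.
  have Nd d : (mu N <= (P `^ (n%:R * j%:~R) * P `^ (- A * d%:R))%:E)%E.
    apply: (@le_trans _ _ (mu (E (j - d%:Z) `&` S j))).
      apply: le_measure; rewrite ?inE//; first exact: measurableI.
      by move=> x [Sx /(_ d I)].
    apply: le_trans (muE _) _; rewrite lee_fin -!powRD_gt0//.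
    rewrite ler_powR ?(ltW P1)// le_eqVlt; apply/orP; left; apply/eqP.
    by rewrite /A intrB -pmulrn; ring.
  have cv : (P `^ (n%:R * j%:~R) * P `^ (- A * d%:R))%:E @[d --> \oo] --> (0 : \bar R)%E.
    apply: cvg_EFin; first exact: nearW.
    rewrite (_ : fine \o _ = geometric (P `^ (n%:R * j%:~R)) (P `^ (- A))); last first.
      by apply/funext => d /=; rewrite [P `^ (- A * _)]powRrM powR_mulrn ?powR_ge0.
    apply: cvg_geometric; rewrite ger0_norm ?powR_ge0//.
    by rewrite powR_lt1// oppr_lt0.
  rewrite -(cvg_lim _ cv)//; apply: lime_ge.
    by apply/cvg_ex; exists 0%E.
  exact: nearW.
pose G x : \bar R := ((L j)%:E +
  \sum_(0 <= d <oo) (P `^ (l * d.+1%:R) * L j * \1_(E (j - d%:Z)) x)%:E)%E.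
have c0 (d : nat) : 0 <= P `^ (l * d.+1%:R) * L j by rewrite mulr_ge0 ?powR_ge0.
have t0 (d : nat) x : (0 <= (P `^ (l * d.+1%:R) * L j * \1_(E (j - d%:Z)) x)%:E)%E.
  by rewrite lee_fin mulr_ge0.
apply: (@le_trans _ _ (\int[mu]_(x in S j) G x)%E).
  apply: (@ge0_le_integral_null _ _ _ _ _ _ N) => //.
  - by move=> x _; rewrite lee_fin.
  - by move=> x _; rewrite adde_ge0 ?lee_fin ?L0// nneseries_ge0.
  - move=> x Nx Sx; split=> //.
    have ex : exists d : nat, h x <= L (j - d%:Z).
      apply: contrapT => /forallNP all; apply: Nx; split=> // d _.
      by rewrite /E/= ltNge; apply/negP; exact: all.
    case: (ex_minnP ex) => -[|d] hd dmin.
      rewrite subr0 in hd; rewrite /G -[leLHS]adde0 leeD ?lee_fin//.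
      exact: nneseries_ge0.
    have Ed : E (j - d%:Z) x.
      by rewrite /E/= ltNge; apply/negP => /dmin; rewrite ltnn.
    rewrite /G -[leLHS]add0e leeD ?lee_fin//.
    apply: (@le_trans _ _ (\sum_(0 <= i < d.+1)
        (P `^ (l * i.+1%:R) * L j * \1_(E (j - i%:Z)) x)%:E)%E); last first.
      by apply: nneseries_lim_ge => i _ _; exact: t0.
    rewrite big_nat_recr//= -[leLHS]add0e leeD//.
      by apply: sume_ge0 => i _; exact: t0.
    by rewrite indicE mem_set// mulr1 lee_fin (le_trans hd).
have mt (d : nat) : measurable_fun (S j)
    (fun x => (P `^ (l * d.+1%:R) * L j * \1_(E (j - d%:Z)) x)%:E).
  by apply/measurable_EFinP; apply: measurable_funM => //; exact: measurable_indic.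
rewrite /G ge0_integralD//; last 3 first.
- by move=> x _; rewrite lee_fin.
- by move=> x _; exact: nneseries_ge0.
- exact: ge0_emeasurable_sum.
rewrite integral_cst// integral_nneseries//.
rewrite -mulrA mulrDl mul1r EFinD leeD//.
  by rewrite mulrC EFinM lee_wpmul2l ?lee_fin// haar_sphere_powR.
pose y := P `^ (l - A).
have y01 : 0 < y < 1 by rewrite powR_gt0// powR_lt1// subr_lt0.
rewrite [X in (_ <= X%:E)%E](_ : _ = P `^ l * (P `^ (n%:R * j%:~R) * L j) / (1 - y)); last by ring.
apply: le_trans (nneseries_geometric_le _ y01); last by rewrite !mulr_ge0 ?powR_ge0.
apply: lee_nneseries => d _; first by move=> _; apply: integral_ge0 => x _; exact: t0.
under eq_integral do rewrite EFinM.
rewrite ge0_integralZl_EFin//; last by apply/measurable_EFinP; exact: measurable_indic.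
rewrite integral_indic//; apply: le_trans (lee_wpmul2l _ (muE _)) _; first by rewrite lee_fin.
rewrite -EFinM lee_fin le_eqVlt; apply/orP; left; apply/eqP.
rewrite /y -powR_mulrn ?powR_ge0// -powRrM [LHS]mulrAC [RHS]mulrAC [RHS]mulrA.
rewrite -!powRD_gt0//; congr (_ `^ _ * _).
by rewrite /A intrB -pmulrn -natr1; ring.
Qed.

End WeightedEstimates.

(** * The kernel of the Hausdorff operator *)

(** The term of index j is at most C b^(-Gm) e_m b^(-(d'-d)|m-j|): decay of H at
    rate d' beats the growth of e at rate d. *)
Lemma geometric_kernel_sum (R : realType) (b d d' G : R) :
  1 < b -> d < d' -> exists2 K : R, 0 <= K &
  forall (H e : int -> R) (C : R) (m : int), 0 <= C -> (forall k, 0 <= H k) ->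
    slowly_varying b d e ->
    (forall k, H k * b `^ (G * k%:~R) <= C * b `^ (- d' * `|k%:~R|)) ->
    (\esum_(j in [set: int]) (H (m - j) * b `^ (- G * j%:~R) * e j)%:E <=
      (C * K * b `^ (- G * m%:~R) * e m)%:E)%E.
Proof.
move=> b1 dd; have b0 : 0 < b by exact: lt_trans b1.
have dd0 : 0 < d' - d by rewrite subr_gt0.
have [K K0 HK] := esum_int_geometric_le b1 dd0.
exists K => // H e C m C0 H0 [e0 he] hH.
pose c := C * b `^ (- G * m%:~R) * e m.
have c0 : 0 <= c by rewrite !mulr_ge0 ?powR_ge0.
apply: (@le_trans _ _ (\esum_(j in [set: int])
    (c%:E * (b `^ (- (d' - d) * `|(m - j)%:~R|))%:E)%E)%E).
  apply: le_esum => j _; rewrite -EFinM lee_fin.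
  have -> : - G * j%:~R = - G * m%:~R + G * (m - j)%:~R by rewrite intrB; ring.
  rewrite powRD_gt0//; apply: (@le_trans _ _ (C * b `^ (- d' * `|(m - j)%:~R|) *
      ((b `^ (d * `|(j - m)%:~R|) * e m) * b `^ (- G * m%:~R)))).
    rewrite [leLHS](_ : _ = H (m - j) * b `^ (G * (m - j)%:~R) *
      (e j * b `^ (- G * m%:~R))); last by ring.
    apply: ler_pM; rewrite ?mulr_ge0 ?powR_ge0//.
    by rewrite ler_wpM2r ?powR_ge0.
  rewrite -[(m - j)%:~R]opprK -intrN opprB normrN.
  have -> : - (d' - d) * `|(j - m)%:~R| = - d' * `|(j - m)%:~R| + d * `|(j - m)%:~R| :> R by ring.
  by rewrite powRD_gt0// /c le_eqVlt; apply/orP; left; apply/eqP; ring.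
rewrite esum_intZ// => [|k]; last by rewrite lee_fin powR_ge0.
rewrite (_ : C * K * _ * _ = c * K); last by rewrite /c; ring.
by rewrite (EFinM c K); apply: lee_wpmul2l; rewrite ?lee_fin.
Qed.

Section HausdorffKernel.
Variables (R : realType) (p : nat) (p_pr : prime p) (n : nat).
Local Notation V := (padic_space p_pr n).
Local Notation P := (p%:R : R).
Local Notation S := (@padic_sphere p p_pr n).
Variables (Phi : V -> R[i]) (psi : R -> R[i]) (beta : R).
Hypothesis radial : forall x, x != 0 -> Phi x = psi (padic_normR R x).

Lemma padic_sphere_neq0 k (x : V) : S k x -> x != 0.
Proof.
move=> xk; rewrite -padic_norm_eq0 xk expfz_neq0// pnatr_eq0.
by rewrite -lt0n prime_gt0.
Qed.

Lemma padic_sphere_scale m j (x y : V) : S m x -> S j y ->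
  S (m - j) (ratr (padic_norm y) *: x).
Proof.
move=> xm yj; rewrite /padic_sphere/= padic_normZ xm yj ratr_pX padic_abs_pX.
by rewrite addrC expfzDr// pnatr_eq0 -lt0n prime_gt0.
Qed.

Lemma profile_scale m j (x y : V) : S m x -> S j y ->
  Phi (ratr (padic_norm y) *: x) = psi (P `^ (m - j)%:~R).
Proof.
move=> xm yj; have xy := padic_sphere_scale xm yj.
by rewrite radial ?(padic_sphere_neq0 xy)// (padic_normR_sphere R xy).
Qed.

(** For y = 0 both sides evaluate Phi at 0, and x = 0 forces x' = 0; in the
    remaining case [profile_scale] applies to x and to x'. *)
Lemma hausdorff_integrand_norm f (x x' : V) : padic_norm x = padic_norm x' ->
  hausdorff_integrand Phi beta f x = hausdorff_integrand Phi beta f x'.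
Proof.
move=> xx'; apply/funext => y; rewrite /hausdorff_integrand; congr (_ / _ * _).
have [x0|x0] := eqVneq x 0.
  suff -> : x' = 0 by rewrite x0.
  by apply/eqP; rewrite -padic_norm_eq0 -xx' x0 padic_norm0.
have [m xm] := padic_sphere_ex x0; have x'm : S m x' by rewrite /padic_sphere/= -xx'.
have [->|y0] := eqVneq y 0; first by rewrite padic_norm0 /ratr mul0r !scale0r.
have [j yj] := padic_sphere_ex y0.
by rewrite (profile_scale xm yj) (profile_scale x'm yj).
Qed.

Lemma normc_hausdorff_integrand f m j (x y : V) : S m x -> S j y ->
  Normc.normc (hausdorff_integrand Phi beta f x y) =
  Normc.normc (psi (P `^ (m - j)%:~R)) * P `^ (- (n%:R - beta) * j%:~R) *
    Normc.normc (f y).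
Proof.
move=> xm yj; rewrite /hausdorff_integrand !Normc.normcM Normc.normcV.
rewrite normc_real ?powR_ge0// (profile_scale xm yj) (padic_normR_sphere R yj).
congr (_ * _ * _); rewrite -powRrM -powRN; congr (_ `^ _); ring.
Qed.

(** The denominator |0|^(n-beta) is 0, and so is its inverse by convention. *)
Lemma hausdorff_integrand0 f (x : V) : beta < n%:R ->
  Normc.normc (hausdorff_integrand Phi beta f x 0) = 0.
Proof.
move=> bn; rewrite /hausdorff_integrand /padic_normR padic_norm0 rmorph0.
rewrite powR0 ?subr_eq0 ?gt_eqF// !Normc.normcM Normc.normcV normc_real//.
by rewrite invr0 mulr0 mul0r.
Qed.

Variable mu : {measure set V -> \bar R}.

(** The integrand vanishes at y = 0, and on each sphere S_j its modulus is a
    constant multiple of h outside N. *)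
Lemma integral_hausdorff_integrand_le f (h : V -> R) (N : set V) (I : int -> R)
    m (x : V) : beta < n%:R ->
  measurable N -> mu N = 0%E -> (forall y, ~ N y -> Normc.normc (f y) = h y) ->
  measurable_fun setT h -> (forall y, 0 <= h y) ->
  (forall j, (\int[mu]_(y in S j) (h y)%:E <= (I j)%:E)%E) -> S m x ->
  (\int[mu]_y (Normc.normc (hausdorff_integrand Phi beta f x y))%:E <=
   \esum_(j in [set: int]) (Normc.normc (psi (P `^ (m - j)%:~R)) *
      P `^ (- (n%:R - beta) * j%:~R) * I j)%:E)%E.
Proof.
move=> bn mN N0 fh mh h0 hI xm.
pose c j := Normc.normc (psi (P `^ (m - j)%:~R)) * P `^ (- (n%:R - beta) * j%:~R).
have c0 j : 0 <= c j by rewrite mulr_ge0 ?normc_ge0 ?powR_ge0.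
pose k y := Normc.normc (hausdorff_integrand Phi beta (fun y => real_complex R (h y)) x y).
have kE j y : S j y -> k y = c j * h y.
  by move=> yj; rewrite /k (normc_hausdorff_integrand _ xm yj) normc_real.
apply: (@le_trans _ _ (\int[mu]_(y in \bigcup_j S j) (k y)%:E)%E).
  rewrite [leRHS]integral_mkcond.
  have k0 y : (\bigcup_j S j) y -> (0 <= (k y)%:E)%E by rewrite lee_fin normc_ge0.
  apply: (@ge0_le_integral_null _ _ _ _ _ _ N) => //.
  - by move=> y _; rewrite lee_fin normc_ge0.
  - by move=> y _; exact: erestrict_ge0.
  move=> y Ny _; split=> //.
  have [->|y0] := eqVneq y 0.
    by rewrite hausdorff_integrand0//; exact: erestrict_ge0.
  have [j yj] := padic_sphere_ex y0.
  rewrite patchE ifT; last by rewrite inE; exists j.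
  by rewrite lee_fin (kE _ _ yj) (normc_hausdorff_integrand _ xm yj) fh.
have mS j : measurable (S j) by exact: measurable_padic_sphere.
have mch j : measurable_fun (S j) (fun y => (c j * h y)%:E).
  apply/measurable_EFinP; apply: measurable_funM => //.
  exact: measurable_funTS.
rewrite ge0_integral_int_bigcup//; last 3 first.
- exact: padic_sphere_trivIset.
- move=> j; apply: (eq_measurable_fun (fun y => (c j * h y)%:E)) => //.
  by move=> y /set_mem/kE ->.
- by move=> j y _; rewrite lee_fin normc_ge0.
apply: le_esum => j _; rewrite (@eq_integral _ _ _ _ _ (fun y => (c j)%:E * (h y)%:E)%E); last first.
  by move=> y /set_mem/kE ->; rewrite EFinM.
rewrite ge0_integralZl_EFin//; last 2 first.
- by move=> y _; rewrite lee_fin.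
- by apply/measurable_EFinP; exact: measurable_funTS.
by rewrite (EFinM (c j) (I j)); apply: lee_wpmul2l; rewrite ?lee_fin.
Qed.

(** B is counted once for the real and once for the imaginary part. *)
Lemma normc_hausdorff_le f (x : V) (B : R) :
  (\int[mu]_y (Normc.normc (hausdorff_integrand Phi beta f x y))%:E <= B%:E)%E ->
  Normc.normc (hausdorff mu Phi beta f x) <= B + B.
Proof.
move=> hB; apply: le_trans (normc_le_ReIm _) _; rewrite /hausdorff /cintegral/=.
apply: lerD; apply: Rintegral_bounded; apply: le_trans hB.
  by apply: ge0_le_integral_all => y _; rewrite lee_fin ?normr_Re_le.
by apply: ge0_le_integral_all => y _; rewrite lee_fin ?normr_Im_le.
Qed.

(** H f is a function of the norm, and any function of the norm is Borel. *)
Lemma hausdorff_ae_measurable f : ae_measurable mu (hausdorff mu Phi beta f).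
Proof.
(* rep t is a point of norm t, when there is one *)
pose rep (t : rat) : V := xget 0 [set x | padic_norm x = t].
have radialH x : hausdorff mu Phi beta f x = hausdorff mu Phi beta f (rep (padic_norm x)).
  rewrite /hausdorff (@hausdorff_integrand_norm f x (rep (padic_norm x)))//.
  by rewrite /rep; case: xgetP => [y _ /= -> //|/(_ x)/= []].
exists (hausdorff mu Phi beta f); split.
- rewrite (_ : (fun x => _) = fun x : V =>
    complex.Re (hausdorff mu Phi beta f (rep (padic_norm x)))); last first.
    by apply/funext => x; rewrite -radialH.
  exact: (@measurable_fun_norm p p_pr n _ _
    (fun t => complex.Re (hausdorff mu Phi beta f (rep t)))).
- rewrite (_ : (fun x => _) = fun x : V =>
    complex.Im (hausdorff mu Phi beta f (rep (padic_norm x)))); last first.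
    by apply/funext => x; rewrite -radialH.
  exact: (@measurable_fun_norm p p_pr n _ _
    (fun t => complex.Im (hausdorff mu Phi beta f (rep t)))).
- exact: aeW.
Qed.

End HausdorffKernel.

(** * Rearrangements *)

Section Rearrangements.
Variables (R : realType) (p : nat) (p_pr : prime p) (n : nat).
Local Notation V := (padic_space p_pr n).
Local Notation P := (p%:R : R).
Local Notation S := (@padic_sphere p p_pr n).
Variable mu : {measure set V -> \bar R}.

Lemma weighted_rearrangement_ge0 w (f : V -> R[i]) t :
  (0 <= weighted_rearrangement mu w f t)%E.
Proof. by apply: le_ereal_inf_tmp => _ [l [/ltW l0 _] <-]; rewrite lee_fin. Qed.

Lemma weighted_rearrangement_nincr w (f : V -> R[i]) t t' : t <= t' ->
  (weighted_rearrangement mu w f t' <= weighted_rearrangement mu w f t)%E.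
Proof.
move=> tt'; apply: ereal_inf_le_tmp => _ [l [l0 lt] <-]; exists l => //; split=> //.
by rewrite (le_trans lt)// lee_fin.
Qed.

(** If |F| <= B outside the ball of radius p^m, then the sets where |F| exceeds
    B lie in this ball, whose weighted measure is at most t. *)
Lemma weighted_rearrangement_le a (F : V -> R[i]) m (B t : R) :
  (0 < n)%N -> is_haar mu -> 0 < n%:R + a -> 0 <= B ->
  (forall k x, m <= k -> S k x -> Normc.normc (F x) <= B) ->
  (1 - P `^ (- (n%:R + a)))^-1 * P `^ ((n%:R + a) * m%:~R) <= t ->
  (weighted_rearrangement mu (power_weight a) F t <= B%:E)%E.
Proof.
move=> n0 haar na0 B0 hB ht; apply/lee_addgt0Pr => e e0; rewrite -EFinD.
apply: ereal_inf_lbound; exists (B + e) => //; split.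
  by rewrite ltr_wpDl.
rewrite /weighted_distribution; apply: (@le_trans _ _ t%:E) => //.
apply: le_trans (_ : _ <= (_ : R)%:E)%E _; last by rewrite lee_fin; exact: ht.
apply: le_trans (integral_power_weight_ball n0 haar m na0).
apply: (@ge0_le_integral_null _ _ _ _ _ _ set0) => //.
- by move=> x _; rewrite lee_fin power_weight_ge0.
- by move=> x _; rewrite lee_fin power_weight_ge0.
- move=> x _ /= Bx; split=> //; have [->|x0] := eqVneq x 0.
    by rewrite /padic_ball/= padic_norm0 exprz_ge0.
  have [k xk] := padic_sphere_ex x0; rewrite /padic_ball/= xk.
  rewrite ler_eXz2l ?ltr1n ?prime_gt1//; rewrite leNgt; apply/negP => mk.
  have := hB k x (ltW mk) xk; apply/negP; rewrite -ltNge.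
  by rewrite (le_lt_trans _ Bx)// lerDl ltW.
Qed.

(** The infimum defining f^*(t) need not be attained, but the distribution
    function is right-continuous: {l < h} is the increasing union of the sets
    {l + 1/(i+1) < h}, each of weighted measure at most t. *)
Lemma weighted_rearrangement_level a (f : V -> R[i]) (h : V -> R) (N : set V) (l t : R) :
  measurable N -> mu N = 0%E -> (forall y, ~ N y -> Normc.normc (f y) = h y) ->
  measurable_fun setT h ->
  (weighted_rearrangement mu (power_weight a) f t <= l%:E)%E ->
  (\int[mu]_(x in [set x | (l < h x)%R]) (power_weight a x)%:E <= t%:E)%E.
Proof.
move=> mN N0 fh mh hl.
pose E i := [set x | l + i.+1%:R^-1 < h x].
have mE i : measurable (E i).
  rewrite (_ : E i = setT `&` h @^-1` `]l + i.+1%:R^-1, +oo[%classic).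
    by apply: mh => //; exact: measurable_itv.
  by apply/seteqP; split=> x /=; rewrite in_itv/= andbT => // -[].
have -> : [set x | l < h x] = \bigcup_i E i.
  apply/seteqP; split=> x /=; last first.
    by move=> [i _]; apply: le_lt_trans; rewrite lerDl.
  by move=> /ltr_add_invr[i hi]; exists i.
have ndE : {homo E : i j / (i <= j)%N >-> (i <= j)%O}.
  move=> i j ij; apply/subsetPset => x; apply: le_lt_trans.
  by rewrite lerD2l lef_pV2 ?posrE// ler_nat ltnS.
have := @ge0_nondecreasing_set_cvg_integral _ V R E
  (fun x => (power_weight a x)%:E) mu ndE mE.
move=> cv; rewrite -(cvg_lim _ (cv _ _))//; last 2 first.
- by move=> i; exact: measurable_power_weight.
- by move=> i x _; rewrite lee_fin power_weight_ge0.
apply: lime_le.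
  apply/cvg_ex; eexists; apply: cv; first by move=> i; exact: measurable_power_weight.
  by move=> i x _; rewrite lee_fin power_weight_ge0.
apply: nearW => i.
have : (weighted_rearrangement mu (power_weight a) f t < (l + i.+1%:R^-1)%:E)%E.
  by apply: (le_lt_trans hl); rewrite lte_fin ltrDl.
move=> /ereal_inf_lt[_ [l' [l'0 hl'] <-]]; rewrite lte_fin => l'l.
apply: le_trans hl'; apply: (@ge0_le_integral_null _ _ _ _ _ _ N) => //.
- by move=> x _; rewrite lee_fin power_weight_ge0.
- by move=> x _; rewrite lee_fin power_weight_ge0.
- by move=> x Nx Ex; split=> //=; rewrite fh//; exact: lt_trans Ex.
Qed.

End Rearrangements.

(** * From one Lorentz norm to the other *)

Lemma slowly_varyingZ (R : realType) (b d c : R) (e : int -> R) : 0 <= c ->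
  slowly_varying b d e -> slowly_varying b d (fun k => c * e k).
Proof.
move=> c0 [e0 ee]; split=> [k|i j]; first exact: mulr_ge0.
by rewrite mulrCA ler_wpM2l.
Qed.

(** The slowly varying majorant of b^(kA/q) phi(b^(kA)), where phi stands for
    the rearrangement of f. *)
Lemma lorentz_envelope (R : realType) (b A q s d : R) :
  1 < b -> 0 < A -> 0 < q -> 1 <= s -> 0 < d ->
  exists2 K : R, 0 <= K & forall phi : R -> \bar R,
    (forall t, (0 <= phi t)%E) ->
    (forall t t', 0 < t -> t <= t' -> (phi t' <= phi t)%E) ->
    (lorentz_integral q s phi < +oo)%E ->
    exists e : int -> R, [/\ slowly_varying b d e,
      forall k : int, (phi (b `^ (A * k%:~R))%R <= (b `^ (- (A / q) * k%:~R) * e k)%:E)%E &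
      (\esum_(k in [set: int]) (e k `^ s)%:E <= K%:E * lorentz_integral q s phi)%E].
Proof.
move=> b1 A0 q0 s1 d0; have s0 : 0 < s by exact: lt_le_trans s1.
have b0 : 0 < b by exact: lt_trans b1.
have [K1 K10 Henv] := envelope b1 d0 s1.
have X1 : 1 < b `^ A by rewrite powR_gt1.
pose K2 := (b `^ A) `^ (s / q) / (1 - (b `^ A)^-1).
have K20 : 0 <= K2.
  by rewrite divr_ge0 ?powR_ge0// subr_ge0 invf_le1 ?(ltW X1)// powR_gt0.
exists (K1 * K2) => [|phi phi0 phin fin]; first exact: mulr_ge0.
have [phifin phisum] := lorentz_integral_ge X1 q0 s0 phi0 phin fin.
pose a (k : int) := (b `^ A) `^ (k%:~R / q) * fine (phi ((b `^ A) `^ k%:~R)).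
have a0 k : 0 <= a k by rewrite mulr_ge0 ?powR_ge0 ?fine_ge0.
have [|e [sv ae sum_e]] := Henv a a0.
  by apply: le_lt_trans phisum _; rewrite lte_mul_pinfty.
exists e; split=> //.
- move=> k; rewrite powRrM -(fineK (phifin k)) lee_fin mulNr powRN mulrC.
  rewrite ler_pdivlMr ?powR_gt0//; apply: le_trans (ae k).
  by rewrite /a mulrC -[in leRHS]powRrM (_ : A * (k%:~R / q) = A / q * k%:~R)//; ring.
- apply: (le_trans sum_e); rewrite EFinM -muleA.
  by apply: lee_wpmul2l phisum; rewrite lee_fin.
Qed.

Section LorentzEstimates.
Variables (R : realType) (p : nat) (p_pr : prime p) (n : nat).
Local Notation V := (padic_space p_pr n).
Local Notation P := (p%:R : R).
Local Notation S := (@padic_sphere p p_pr n).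
Variable mu : {measure set V -> \bar R}.
Hypotheses (n0 : (0 < n)%N) (haar : is_haar mu).

Let P1 : 1 < P. Proof. exact: padic_base_gt1. Qed.
Let P0 : 0 < P. Proof. exact: padic_base_gt0. Qed.

Lemma ae_measurable_modulus (f : V -> R[i]) : ae_measurable mu f ->
  exists (h : V -> R) (N : set V), [/\ measurable N, mu N = 0%E,
    forall y, ~ N y -> Normc.normc (f y) = h y,
    measurable_fun setT h & forall y, 0 <= h y].
Proof.
move=> [g [mRe mIm [N [mN N0 fgN]]]].
exists (fun y => Normc.normc (g y)), N; split=> //.
- by move=> y Ny; congr Normc.normc; apply: contrapT => /fgN.
- rewrite (_ : (fun y => _) = fun y =>
      (complex.Re (g y) ^+ 2 + complex.Im (g y) ^+ 2) `^ 2^-1); last first.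
    apply/funext => y; rewrite powR12_sqrt ?addr_ge0 ?sqr_ge0//.
    by case: (g y).
  apply: (measurableT_comp (measurable_powR _)).
  by apply: measurable_funD; exact: measurable_funX.
- by move=> y; exact: normc_ge0.
Qed.

(** [integral_sphere_le] for the levels L k = p^(-kA/q) e_k with A = n + alpha:
    these grow at rate A/q + d when k decreases, and d < A - A/q keeps that
    rate below A. *)
Lemma sphere_average_le (alpha q d : R) : 0 < n%:R + alpha ->
  d < (n%:R + alpha) - (n%:R + alpha) / q ->
  exists2 C : R, 0 <= C & forall (f : V -> R[i]) (h : V -> R) (N : set V) (e : int -> R),
    measurable N -> mu N = 0%E -> (forall y, ~ N y -> Normc.normc (f y) = h y) ->
    measurable_fun setT h -> (forall y, 0 <= h y) -> slowly_varying P d e ->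
    (forall k : int, (weighted_rearrangement mu (power_weight alpha) f
        (P `^ ((n%:R + alpha) * k%:~R))%R <=
      (P `^ (- ((n%:R + alpha) / q) * k%:~R) * e k)%:E)%E) ->
    forall j, (\int[mu]_(y in S j) (h y)%:E <=
      (C * P `^ ((n%:R - (n%:R + alpha) / q) * j%:~R) * e j)%:E)%E.
Proof.
set A := n%:R + alpha => A0 dgap.
have lA : A / q + d < A by rewrite -ltrBrDl.
exists (1 + P `^ (A / q + d) / (1 - P `^ (A / q + d - A))).
  by rewrite addr_ge0// divr_ge0 ?powR_ge0// subr_ge0 ltW// powR_lt1// subr_lt0.
move=> f h N e mN N0 fh mh h0 [e0 ee] hf j.
set C := 1 + _ / _.
have -> : C * P `^ ((n%:R - A / q) * j%:~R) * e j =
    C * P `^ (n%:R * j%:~R) * (P `^ (- (A / q) * j%:~R) * e j).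
  by rewrite mulrBl powRD_gt0// mulNr; ring.
apply: (integral_sphere_le (L := fun j => P `^ (- (A / q) * j%:~R) * e j)
    haar A0 lA mh h0) => [i|i|k].
- by rewrite mulr_ge0 ?powR_ge0.
- exact: (weighted_rearrangement_level mN N0 fh mh (hf i)).
- apply: le_trans (ler_wpM2l (powR_ge0 _ _) (ee (j - k%:Z) j)) _.
  rewrite addrAC subrr add0r !mulrA ler_wpM2r//.
  rewrite -!powRD_gt0// ler_powR ?(ltW P1)// intrN normrN -pmulrn normr_nat intrB -pmulrn.
  by rewrite le_eqVlt; apply/orP; left; apply/eqP; ring.
Qed.

(** As d <= B/r with B = n + gamma, the bounds p^(-mB/r) e_m decrease in m.
    Hence |F| is bounded by the m-th one outside the ball of radius p^m, and
    the rearrangement of F is bounded by it from c p^(mB) on, where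
    c = 1/(1 - p^-B) comes from [integral_power_weight_ball]. *)
Lemma radial_lorentz_le (gamma r s d : R) : 0 < n%:R + gamma -> 0 < r -> 0 < s ->
  d <= (n%:R + gamma) / r ->
  exists2 C : R, 0 <= C & forall (F : V -> R[i]) (e : int -> R), slowly_varying P d e ->
    (forall m x, S m x -> Normc.normc (F x) <= P `^ (- ((n%:R + gamma) / r) * m%:~R) * e m) ->
    (lorentz_integral r s (weighted_rearrangement mu (power_weight gamma) F) <=
      C%:E * \esum_(k in [set: int]) (e k `^ s)%:E)%E.
Proof.
set B := n%:R + gamma => B0 r0 s0 dB.
have c0 : 0 < (1 - P `^ (- B))^-1 by rewrite invr_gt0 subr_gt0 powR_lt1// oppr_lt0.
have Y1 : 1 < P `^ B by rewrite powR_gt1.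
exists ((1 - P `^ (- B))^-1 `^ (s / r) * (P `^ B) `^ (s / r) * (P `^ B - 1)).
  by rewrite !mulr_ge0 ?powR_ge0// subr_ge0 ltW.
move=> F e [e0 ee] hF.
pose u m := P `^ (- (B / r) * m%:~R) * e m.
have u0 m : 0 <= u m by rewrite mulr_ge0 ?powR_ge0.
have und m k : m <= k -> u k <= u m.
  move=> mk; rewrite /u; apply: le_trans (ler_wpM2l (powR_ge0 _ _) (ee k m)) _.
  rewrite mulrA ler_wpM2r// -powRD_gt0// ler_powR ?(ltW P1)//.
  have km : 0 <= (k - m)%:~R :> R by rewrite ler0z subr_ge0.
  rewrite (ger0_norm km); move: km dB; rewrite intrB; move: (B / r) => G; nra.
have phiu k t : geo_itv (P `^ B) (1 - P `^ (- B))^-1 k t ->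
    (weighted_rearrangement mu (power_weight gamma) F t <= (u k)%:E)%E.
  rewrite /geo_itv/= in_itv/= => /andP[ht _].
  apply: (weighted_rearrangement_le (m := k) n0 haar B0 (u0 k)).
    by move=> l x kl /hF /le_trans; apply; exact: und.
  by rewrite -/B powRrM.
apply: le_trans (lorentz_integral_le Y1 r0 s0 c0 u0
    (weighted_rearrangement_ge0 _ _ _) phiu) _.
rewrite le_eqVlt; apply/orP; left; apply/eqP; congr (_ * _)%E.
apply: eq_esum => k _; congr ((_ `^ _)%:E).
rewrite /u mulrA -powRrM -powRD_gt0// (_ : B * (k%:~R / r) + _ = 0) ?powRr0 ?mul1r//.
by ring.
Qed.

Lemma lorentz_normE q s w (f : V -> R[i]) : lorentz_norm mu q s w f =
  (((s / q)%:E * lorentz_integral q s (weighted_rearrangement mu w f)) `^ s^-1)%E.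
Proof. by []. Qed.

Lemma lorentz_integral_lty q s w (f : V -> R[i]) : 0 < q -> 0 < s ->
  (lorentz_norm mu q s w f < +oo)%E ->
  (lorentz_integral q s (weighted_rearrangement mu w f) < +oo)%E.
Proof.
move=> q0 s0; rewrite lorentz_normE => norm_fin.
have : s^-1 != 0 by rewrite invr_eq0 gt_eqF.
move=> /lty_poweRy /(_ norm_fin) h; rewrite ltey; apply/eqP => Iy; move: h.
by rewrite Iy gt0_muley ?lte_fin ?divr_gt0// ltxx.
Qed.

Lemma lorentz_norm_le q r s w w' (f F : V -> R[i]) (E : R) :
  0 < q -> 0 < r -> 0 < s -> 0 <= E ->
  (lorentz_integral r s (weighted_rearrangement mu w' F) <=
     E%:E * lorentz_integral q s (weighted_rearrangement mu w f))%E ->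
  (lorentz_norm mu r s w' F <=
     ((s / r * E / (s / q)) `^ s^-1)%:E * lorentz_norm mu q s w f)%E.
Proof.
move=> q0 r0 s0 E0 I_le; rewrite !lorentz_normE.
have := lorentz_integral_ge0 q s (weighted_rearrangement mu w f).
have := lorentz_integral_ge0 r s (weighted_rearrangement mu w' F).
move: (lorentz_integral r s _) (lorentz_integral q s _) I_le => I' I I_le I'0 I0.
have sq0 : 0 < s / q by rewrite divr_gt0.
have sr0 : 0 < s / r by rewrite divr_gt0.
have c0 : 0 <= s / r * E / (s / q) by rewrite divr_ge0 ?(ltW sq0)// mulr_ge0 ?(ltW sr0).
rewrite -poweR_EFin -poweRM ?lee_fin//; last by rewrite mule_ge0// lee_fin ltW.
have le_core : ((s / r)%:E * I' <= (s / r * E / (s / q))%:E * ((s / q)%:E * I))%E.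
  rewrite muleA -EFinM divfK ?gt_eqF// (EFinM (s / r) E) -muleA.
  by apply: lee_wpmul2l I_le; rewrite lee_fin ltW.
have lhs0 : (0 <= (s / r)%:E * I')%E by rewrite mule_ge0// lee_fin ltW.
apply: (gt0_ler_poweR _ _ _ le_core); rewrite ?invr_ge0 ?(ltW s0)//.
- by rewrite in_itv/= leey andbT.
- rewrite in_itv/= leey andbT; exact: le_trans le_core.
Qed.

Section PointwiseBound.
Variables (Phi : V -> R[i]) (psi : R -> R[i]) (beta : R).
Hypothesis radial : forall x, x != 0 -> Phi x = psi (padic_normR R x).

(** Here Q stands for A/q.  The term of index j is
    |psi(p^(m-j))| p^(-(n-beta)j) p^((n-Q)j) C e_j, and the powers of p combine
    to p^(-(Q-beta)j), as in [geometric_kernel_sum]. *)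
Lemma hausdorff_pointwise_le (Q d d' C D : R) : beta < n%:R -> d < d' ->
  0 <= C -> 0 <= D ->
  (forall k : int, Normc.normc (psi (P `^ k%:~R)) * P `^ ((Q - beta) * k%:~R) <=
    D * P `^ (- d' * `|k%:~R|)) ->
  exists2 K : R, 0 <= K & forall (f : V -> R[i]) (h : V -> R) (N : set V) (e : int -> R),
    measurable N -> mu N = 0%E -> (forall y, ~ N y -> Normc.normc (f y) = h y) ->
    measurable_fun setT h -> (forall y, 0 <= h y) -> slowly_varying P d e ->
    (forall j, (\int[mu]_(y in S j) (h y)%:E <=
      (C * P `^ ((n%:R - Q) * j%:~R) * e j)%:E)%E) ->
    forall m x, S m x ->
      (\int[mu]_y (Normc.normc (hausdorff_integrand Phi beta f x y))%:E <=
        (K * P `^ (- (Q - beta) * m%:~R) * e m)%:E)%E.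
Proof.
move=> bn dd' C0 D0 hD.
have [K2 K20 Hker] := geometric_kernel_sum (Q - beta) P1 dd'.
exists (D * K2 * C); first by rewrite !mulr_ge0.
move=> f h N e mN N0 fh mh h0 sv sphere m x xm.
apply: le_trans (integral_hausdorff_integrand_le radial bn mN N0 fh mh h0 sphere xm) _.
have -> : D * K2 * C * P `^ (- (Q - beta) * m%:~R) * e m =
  D * K2 * P `^ (- (Q - beta) * m%:~R) * (C * e m) by ring.
apply: le_trans (Hker (fun k => Normc.normc (psi (P `^ k%:~R))) (fun k => C * e k)
   D m D0 (fun=> normc_ge0 _) (slowly_varyingZ C0 sv) hD).
apply: le_esum => j _; rewrite lee_fin le_eqVlt; apply/orP; left; apply/eqP.
rewrite [LHS](_ : _ = Normc.normc (psi (P `^ (m - j)%:~R)) *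
  (P `^ (- (n%:R - beta) * j%:~R) * P `^ ((n%:R - Q) * j%:~R)) * (C * e j)); last by ring.
by rewrite -powRD_gt0//; congr (_ * _ `^ _ * _); ring.
Qed.

End PointwiseBound.

End LorentzEstimates.

Lemma exists_small_rate (R : realType) (a b c : R) : 0 < a -> 0 < b -> 0 < c ->
  exists d : R, [/\ 0 < d, d <= a, d < b & d < c].
Proof.
move=> a0 b0 c0; have m0 : 0 < Num.min a (Num.min b c) by rewrite !lt_min a0 b0.
have : Num.min a (Num.min b c) <= a by rewrite ge_min lexx.
have : Num.min a (Num.min b c) <= b by rewrite !ge_min lexx orbT.
have : Num.min a (Num.min b c) <= c by rewrite !ge_min lexx !orbT.
move: (Num.min _ _) m0 => m m0 mc mb ma; exists (m / 2).
by split; lra.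
Qed.

Theorem theorem4p2 (R : realType) (p : nat) (p_pr : prime p) (n : nat)
    (mu : {measure set (padic_space p_pr n) -> \bar R})
    (alpha beta gamma q r s eps : R)
    (Phi : padic_space p_pr n -> R[i]) (psi : R -> R[i]) :
  (1 <= n)%N ->
  is_haar mu ->
  0 <= beta < n%:R ->
  1 <= q -> 1 <= r -> 1 <= s ->
  - n%:R < Num.min alpha gamma ->
  (n%:R + alpha) / q - beta = (n%:R + gamma) / r ->
  (forall (k : int) (t : R), (p%:R : R) ^ k <= t < (p%:R : R) ^ (k + 1) ->
     psi t = psi ((p%:R : R) ^ k)) ->
  (forall x, x != 0 -> Phi x = psi (padic_normR R x)) ->
  0 < eps ->
  1 < q - eps ->
  (forall u u' : R, u = q - eps \/ u = q + eps -> u^-1 + u'^-1 = 1 ->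
     (\int[lebesgue_measure]_(t in `]0%R, +oo[)
        (Normc.normc (psi t) `^ u'
           * t `^ ((n%:R + alpha) * (u' - 1) - beta * u' - 1))%:E < +oo)%E) ->
  exists C : R, forall f : padic_space p_pr n -> R[i],
    in_lorentz mu q s (power_weight alpha) f ->
    [/\ {ae mu, forall x, hausdorff_converges mu Phi beta f x},
        in_lorentz mu r s (power_weight gamma)
          (hausdorff mu Phi beta f) &
        (lorentz_norm mu r s (power_weight gamma)
           (hausdorff mu Phi beta f)
         <= C%:E * lorentz_norm mu q s (power_weight alpha) f)%E].
Proof.
move=> n0 haar /andP[_ bn] q1 r1 s1 min_n hom psistep radial eps0 qe1 psiint.
have [na0 ng0] : 0 < n%:R + alpha /\ 0 < n%:R + gamma.
  by move: min_n; rewrite lt_min => /andP[]; split; lra.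
have q_gt1 : 1 < q by lra.
have q0 : 0 < q by lra.
have r0 : 0 < r by lra.
have s0 : 0 < s by lra.
have G0 : 0 < (n%:R + gamma) / r by rewrite divr_gt0.
have gap0 : 0 < (n%:R + alpha) - (n%:R + alpha) / q.
  by rewrite subr_gt0 ltr_pdivrMr// ltr_pMr.
have [D [d' [D0 d'0 decay]]] := profile_decay (@padic_base_gt1 R p p_pr) na0 eps0 qe1 psistep psiint.
(* The majorant may vary no faster than each of the three geometric rates: those
   of the profile, of the averages over spheres, and of the output weight. *)
have [d [d0 dG dd' dgap]] := exists_small_rate G0 d'0 gap0.
have [K K0 env] := lorentz_envelope (@padic_base_gt1 R p p_pr) na0 q0 s1 d0.
have [C C0 sphere] := sphere_average_le haar na0 dgap.
have [M M0 pointwise] := hausdorff_pointwise_le mu radial bn dd' C0 D0 decay.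
have [L L0 output] := radial_lorentz_le n0 haar ng0 r0 s0 dG.
pose E := L * ((M + M) `^ s * K).
have E0 : 0 <= E by rewrite !mulr_ge0 ?powR_ge0.
exists ((s / r * E / (s / q)) `^ s^-1) => f [mf norm_fin].
set phi := weighted_rearrangement mu (power_weight alpha) f.
have Ifin := lorentz_integral_lty q0 s0 norm_fin.
have [e [sv level sum_e]] := env phi (weighted_rearrangement_ge0 _ _ _)
  (fun t t' _ => @weighted_rearrangement_nincr _ _ _ _ _ _ _ t t') Ifin.
have [h [N [mN N0 fh mh h0]]] := ae_measurable_modulus mf.
have sph := sphere f h N e mN N0 fh mh h0 sv level.
have point := pointwise f h N e mN N0 fh mh h0 sv sph.
pose Hf := hausdorff mu Phi beta f.
have I_le : (lorentz_integral r s (weighted_rearrangement mu (power_weight gamma) Hf) <=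
    E%:E * lorentz_integral q s phi)%E.
  have MM : 0 <= M + M by exact: addr_ge0.
  apply: le_trans (output Hf _ (slowly_varyingZ MM sv) _) _.
  - move=> m x /point /normc_hausdorff_le /le_trans; apply.
    by rewrite -hom le_eqVlt; apply/orP; left; apply/eqP; ring.
  rewrite EFinM -muleA; apply: lee_wpmul2l; first by rewrite lee_fin.
  rewrite EFinM -muleA; apply: le_trans (lee_wpmul2l _ sum_e); last by rewrite lee_fin powR_ge0.
  rewrite -esum_intZ ?powR_ge0//; last by move=> k; rewrite lee_fin powR_ge0.
  by apply: le_esum => k _; rewrite -EFinM -powRM//; case: sv.
have norm_le := lorentz_norm_le q0 r0 s0 E0 I_le.
split.
- exists [set 0]; split.
  + exact: measurable_padic_zero.
  + exact: haar_set0.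
  + move=> x /= hx; apply: contrapT => /eqP x0; apply: hx.
    have [m xm] := padic_sphere_ex x0.
    by rewrite /hausdorff_converges (le_lt_trans (point m x xm))// ltry.
- split; first exact: (hausdorff_ae_measurable _ radial).
  apply: le_lt_trans norm_le _.
  by rewrite lte_mul_pinfty// ?lee_fin ?powR_ge0.
- exact: norm_le.
Qed.
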